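(* Let $n\ge1$ be an integer. The outer measure $\boldsymbol{\kappa}:\mathcal{P}(\mathbb{R}^n)\to[0,1]$ given by $\boldsymbol{\kappa}(E)=2^{-\mathrm{K}(E)}$ is locally optimal.
   Context: Here $\mathbb{N}=\{0,1,2,\ldots\}$. Fix a universal prefix Turing machine $U$ (the domain of a prefix machine is a prefix-free set of binary strings; universality gives, for each prefix machine $M$, a constant $c_M$ such that whenever $M(\pi)=w$ there is $\pi'$ with $U(\pi')=w$ and $|\pi'|\le|\pi|+c_M$). The prefix Kolmogorov complexity is $\mathrm{K}(w)=\min\{|\pi|\mid U(\pi)=w\}$, extended from binary strings to countable domains such as $\mathbb{Q}^n$ by fixed standard binary encodings. For $E\subseteq\mathbb{R}^n$, $\mathrm{K}(E)=\min\{\mathrm{K}(q)\mid q\in E\cap\mathbb{Q}^n\}$, with $\min\emptyset=\infty$, and $2^{-\infty}=0$. The function $\boldsymbol\kappa$ is an outer measure on $\mathbb{R}^n$. An outer measure on $\mathbb{R}^n$ is a function $\mu:\mathcal{P}(\mathbb{R}^n)\to[0,\infty]$ with $\mu(\emptyset)=0$ that is monotone and countably subadditive. It is *supported on $\mathbb{Q}^n$* if $\mu(\mathbb{R}^n\setminus\mathbb{Q}^n)=0$. It is *finitely supported on $\mathbb{Q}^n$* if for every $\varepsilon>0$ there is a finite set $A\subseteq\mathbb{Q}^n$ with $\mu(\mathbb{R}^n\setminus A)<\varepsilon$. It is *strongly finite* if it is supported on $\mathbb{Q}^n$ and $\sum_{q\in\mathbb{Q}^n}\mu(\{q\})<\infty$.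 It is *lower semicomputable* if it is finitely supported on $\mathbb{Q}^n$ and there is a computable function $\hat\mu:\mathcal{P}^{<\omega}(\mathbb{Q}^n)\times\mathbb{N}\to\mathbb{Q}\cap[0,\infty)$ (where $\mathcal{P}^{<\omega}(\mathbb{Q}^n)$ is the set of all finite subsets of $\mathbb{Q}^n$) such that for all finite $A\subseteq\mathbb{Q}^n$: (i) $\hat\mu(A,s)\le\hat\mu(A,t)\le\mu(A)$ whenever $s\le t$; (ii) $\lim_{t\to\infty}\hat\mu(A,t)=\mu(A)$. For $m=(m_1,\ldots,m_n)\in\mathbb{Z}^n$ and $r\in\mathbb{N}$, the $r$-dyadic cube with address $m$ is $Q_m^{(r)}=\{2^{-r}x\mid x\in[m_1,m_1+1)\times\cdots\times[m_n,m_n+1)\}$, and $\mathcal{Q}^{(r)}=\{Q_m^{(r)}\mid m\in\mathbb{Z}^n\}$. For outer measures $\mu,\nu$ on $\mathbb{R}^n$, $\mu$ *dominates $\nu$ on dyadic cubes* if there is a function $\beta:\mathbb{N}\to(0,\infty)$ with $\beta(r)=2^{-o(r)}$ as $r\to\infty$ such that $\mu(E)\ge\beta(r)\nu(E)$ for every $r\in\mathbb{N}$ and every $E\in\mathcal{Q}^{(r)}$. An outer measure $\mu$ on $\mathbb{R}^n$ is *locally optimal* if (i) $\mu$ is strongly finite and lower semicomputable, and (ii) $\mu$ dominates every strongly finite, lower semicomputable outer measure $\nu$ on $\mathbb{R}^n$ on dyadic cubes. *)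

(* Defs.v *)
From HB Require Import structures.
From Stdlib Require Import BinNums.
From mathcomp Require Import all_boot all_order all_algebra.
From mathcomp Require Import finmap.
From mathcomp Require Import all_classical all_reals all_analysis.

Set Implicit Arguments.
Unset Strict Implicit.
Unset Printing Implicit Defensive.

Import Order.TTheory GRing.Theory Num.Theory.
Import numFieldNormedType.Exports.

Local Open Scope classical_set_scope.
Local Open Scope ring_scope.

(** * Turing machines

    Deterministic machines with finitely many two-way infinite tapes over a
    finite alphabet consisting of the blank [None], the input bits
    [Some (inl b)] and auxiliary symbols [Some (inr g)]. *)

Definition bitstring := seq bool.

Definition cell (G : finType) : finType := option (bool + G)%type.

Inductive direction := MoveL | Stay | MoveR.

(* [Tape l x r]: [x] is under the head, [l] and [r] list the cells to its left
   and right, nearest first; all cells beyond [l] and [r] are blank. *)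
Record tape (G : finType) :=
  Tape { tape_left : seq (cell G); tape_head : cell G; tape_right : seq (cell G) }.

Definition string_tape (G : finType) (w : bitstring) : tape G :=
  let s := [seq Some (inl b) : cell G | b <- w] in
  Tape [::] (head None s) (behead s).

Definition write_move (G : finType) (t : tape G) (a : cell G * direction) :
    tape G :=
  let: Tape l _ r := t in
  match a.2 with
  | MoveL => Tape (behead l) (head None l) (a.1 :: r)
  | Stay => Tape l a.1 r
  | MoveR => Tape (a.1 :: l) (head None r) (behead r)
  end.

(* The machine has [tm_tapes.+1] tapes; it halts when [tm_delta] is [None]. *)
Record turing_machine := TuringMachine {
  tm_tapes : nat;
  tm_symbol : finType;
  tm_state : finType;
  tm_start : tm_state;
  tm_delta : tm_state -> {ffun 'I_tm_tapes.+1 -> cell tm_symbol} ->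
    option (tm_state * ('I_tm_tapes.+1 -> cell tm_symbol * direction)) }.

Definition tm_config (M : turing_machine) : Type :=
  (tm_state M * {ffun 'I_(tm_tapes M).+1 -> tape (tm_symbol M)})%type.

(* The input is written on tape 0, with the head on its first bit. *)
Definition tm_init (M : turing_machine) (w : bitstring) : tm_config M :=
  (tm_start M, [ffun i => string_tape _ (if i == ord0 then w else [::])]).

Definition tm_step (M : turing_machine) (c : tm_config M) :
    option (tm_config M) :=
  if tm_delta c.1 [ffun i => tape_head (c.2 i)] is Some (q, act)
  then Some (q, [ffun i => write_move (c.2 i) (act i)])
  else None.

(* [Some c'] if a halting configuration [c'] is reached from [c] in at most
   [k] steps. *)
Fixpoint tm_run (M : turing_machine) (k : nat) (c : tm_config M) :
    option (tm_config M) :=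
  if tm_step c is Some c' then
    if k is k'.+1 then tm_run k' c' else None
  else Some c.

Fixpoint leading_bits (G : finType) (s : seq (cell G)) : bitstring :=
  if s is Some (inl b) :: s' then b :: leading_bits s' else [::].

(* The output is the maximal run of bits on tape 0 starting at the head. *)
Definition tm_output (M : turing_machine) (c : tm_config M) : bitstring :=
  let t := c.2 ord0 in leading_bits (tape_head t :: tape_right t).

(* [computes M p w] is M(p) = w. *)
Definition computes (M : turing_machine) (p w : bitstring) : Prop :=
  exists k (c : tm_config M),
    tm_run k (tm_init M p) = Some c /\ tm_output c = w.

Definition halting_set (M : turing_machine) : set bitstring :=
  [set p | exists w, computes M p w].

Definition prefix_machine (M : turing_machine) : Prop :=
  forall p p', halting_set M p -> halting_set M p' -> prefix p p' -> p = p'.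

Definition universal_prefix_machine (U : turing_machine) : Prop :=
  prefix_machine U /\
  forall M, prefix_machine M -> exists c : nat, forall p w, computes M p w ->
    exists p', computes U p' w /\ (size p' <= size p + c)%N.

(** * Standard binary encodings *)

(* Binary numeral, least significant bit first; 0 is the empty string. *)
Fixpoint positive_code (p : positive) : bitstring :=
  match p with
  | xH => [:: true]
  | xO p' => false :: positive_code p'
  | xI p' => true :: positive_code p'
  end.

Definition nat_code (m : nat) : bitstring :=
  if bin_of_nat m is Npos p then positive_code p else [::].

Definition int_code (z : int) : bitstring := (z < 0) :: nat_code `|z|%N.

(* The self-delimiting version 1^{|w|} 0 w of w. *)
Definition delimited (w : bitstring) : bitstring :=
  nseq (size w) true ++ false :: w.

Definition pair_code (u v : bitstring) : bitstring := delimited u ++ v.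

Definition seq_code (s : seq bitstring) : bitstring :=
  flatten [seq delimited w | w <- s].

Definition rat_code (q : rat) : bitstring :=
  pair_code (int_code (numq q)) (int_code (denq q)).

Definition vec_code (n : nat) (q : 'rV[rat]_n) : bitstring :=
  seq_code [seq rat_code (q ord0 i) | i <- enum 'I_n].

(* A finite set is presented by any list of its elements, in any order and
   possibly with repetitions. *)
Definition finset_name (n : nat) (A : {fset 'rV[rat]_n}) (w : bitstring) : Prop :=
  exists s : seq 'rV[rat]_n, s =i A /\ w = seq_code [seq vec_code q | q <- s].

Definition computable_approx (n : nat) (f : {fset 'rV[rat]_n} -> nat -> rat) :
    Prop :=
  exists M : turing_machine, forall A t w, finset_name A w ->
    computes M (pair_code w (nat_code t)) (rat_code (f A t)).

(** * Outer measures on R^n *)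

Definition ratvec (R : realType) (n : nat) (q : 'rV[rat]_n) : 'rV[R]_n :=
  map_mx ratr q.
Arguments ratvec R {n} q.

Definition rational_points (R : realType) (n : nat) : set 'rV[R]_n :=
  range (ratvec R).
Arguments rational_points : clear implicits.

Definition finset_points (R : realType) (n : nat) (A : {fset 'rV[rat]_n}) :
    set 'rV[R]_n :=
  ratvec R @` [set` A].
Arguments finset_points R {n} A.

Definition rationally_supported (R : realType) (n : nat)
    (mu : {outer_measure set 'rV[R]_n -> \bar R}) : Prop :=
  mu (~` rational_points R n) = 0%E.

Definition finitely_supported (R : realType) (n : nat)
    (mu : {outer_measure set 'rV[R]_n -> \bar R}) : Prop :=
  forall eps : R, 0 < eps -> exists A : {fset 'rV[rat]_n},
    (mu (~` finset_points R A) < eps%:E)%E.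

Definition strongly_finite (R : realType) (n : nat)
    (mu : {outer_measure set 'rV[R]_n -> \bar R}) : Prop :=
  rationally_supported mu /\
  (\esum_(q in [set: 'rV[rat]_n]) mu [set ratvec R q] < +oo)%E.

Definition lower_semicomputable (R : realType) (n : nat)
    (mu : {outer_measure set 'rV[R]_n -> \bar R}) : Prop :=
  finitely_supported mu /\
  exists muhat : {fset 'rV[rat]_n} -> nat -> rat,
    [/\ computable_approx muhat,
        forall A t, 0 <= muhat A t,
        forall A s t, (s <= t)%N ->
          muhat A s <= muhat A t /\
          ((ratr (muhat A t) : R)%:E <= mu (finset_points R A))%E
      & forall A, (fun t => (ratr (muhat A t) : R)%:E) @ \oo -->
          mu (finset_points R A)].

Definition dyadic_cube (R : realType) (n : nat) (r : nat) (m : 'rV[int]_n) :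
    set 'rV[R]_n :=
  [set 2 ^- r *: x | x in
    [set x : 'rV[R]_n | forall i,
      (m ord0 i)%:~R <= x ord0 i < (m ord0 i + 1)%:~R]].

Definition dyadic_cubes (R : realType) (n : nat) (r : nat) :
    set (set 'rV[R]_n) :=
  range (@dyadic_cube R n r).
Arguments dyadic_cubes R n r : clear implicits.

(* beta(r) = 2^{-o(r)} as r -> oo *)
Definition exp2_littleo (R : realType) (beta : nat -> R) : Prop :=
  exists2 f : nat -> R, f =o_\oo (fun r : nat => r%:R : R) &
    forall r, beta r = 2 `^ (- f r).

Definition dominates_on_dyadic_cubes (R : realType) (n : nat)
    (mu nu : {outer_measure set 'rV[R]_n -> \bar R}) : Prop :=
  exists beta : nat -> R,
    [/\ forall r, 0 < beta r, exp2_littleo beta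
      & forall r E, dyadic_cubes R n r E -> ((beta r)%:E * nu E <= mu E)%E].

Definition locally_optimal (R : realType) (n : nat)
    (mu : {outer_measure set 'rV[R]_n -> \bar R}) : Prop :=
  [/\ strongly_finite mu, lower_semicomputable mu
    & forall nu : {outer_measure set 'rV[R]_n -> \bar R},
        strongly_finite nu -> lower_semicomputable nu ->
        dominates_on_dyadic_cubes mu nu].

(** * Kolmogorov complexity and the outer measure kappa *)

(* Infima of sets of naturals (and +oo) are minima, and the infimum of the
   empty set is +oo; see [ereal_inf_nat_attained]. *)
Definition string_complexity (R : realType) (U : turing_machine)
    (w : bitstring) : \bar R :=
  ereal_inf [set (size p)%:R%:E | p in [set p | computes U p w]].
Arguments string_complexity : clear implicits.

Definition vec_complexity (R : realType) (U : turing_machine) (n : nat)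
    (q : 'rV[rat]_n) : \bar R :=
  string_complexity R U (vec_code q).
Arguments vec_complexity R U {n} q.

Definition set_complexity (R : realType) (U : turing_machine) (n : nat)
    (E : set 'rV[R]_n) : \bar R :=
  ereal_inf [set vec_complexity R U q | q in [set q | E (ratvec R q)]].

(* 2^{-x}; the value at -oo is never used. *)
Definition exp2N (R : realType) (x : \bar R) : \bar R :=
  match x with
  | EFin r => (2 `^ (- r))%:E
  | +oo%E => 0%E
  | -oo%E => +oo%E
  end.

Definition kappa (R : realType) (n : nat) (U : turing_machine)
    (E : set 'rV[R]_n) : \bar R :=
  exp2N (set_complexity U E).
Arguments kappa R n U E : clear implicits.

Definition extended_nat (R : realType) : set (\bar R) :=
  [set x | x = +oo%E \/ exists k : nat, x = k%:R%:E].

Lemma ereal_inf_nat_attained (R : realType) (S : set (\bar R)) :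
  S `<=` @extended_nat R -> S !=set0 -> S (ereal_inf S).
Proof.
move=> SN [x Sx].
have [[k0 Sk0]|noS] := pselect (exists k : nat, S k%:R%:E); last first.
  have S1 y : S y -> y = +oo%E.
    move=> Sy; have [//|[k yk]] := SN _ Sy.
    by exfalso; apply: noS; exists k; rewrite -yk.
  suff -> : ereal_inf S = +oo%E by rewrite -(S1 _ Sx).
  apply/eqP; rewrite -leye_eq; apply: le_ereal_inf_tmp => y /S1 -> //.
have ex : exists k, `[< S k%:R%:E >] by exists k0; apply/asboolP.
have [k /asboolP Sk kmin] := ex_minnP ex.
suff -> : ereal_inf S = k%:R%:E by [].
apply/eqP; rewrite eq_le; apply/andP; split; first by apply: ereal_inf_lbound.
apply: le_ereal_inf_tmp => y Sy; have [->|[j yj]] := SN _ Sy.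
  by rewrite leey.
by rewrite yj lee_fin ler_nat; apply: kmin; apply/asboolP; rewrite -yj.
Qed.

Lemma extended_nat_inf (R : realType) (S : set (\bar R)) :
  S `<=` @extended_nat R -> extended_nat (ereal_inf S).
Proof.
move=> SN; have [->|/set0P S0] := eqVneq S set0; first by rewrite ereal_inf0; left.
exact: (SN _ (ereal_inf_nat_attained SN S0)).
Qed.

Lemma vec_complexity_nat (R : realType) U n (q : 'rV[rat]_n) :
  extended_nat (vec_complexity R U q).
Proof. by apply: extended_nat_inf => _ [p _ <-]; right; exists (size p). Qed.

Lemma set_complexity_nat (R : realType) U n (E : set 'rV[R]_n) :
  extended_nat (set_complexity U E).
Proof. by apply: extended_nat_inf => _ [q _ <-]; exact: vec_complexity_nat. Qed.

Lemma exp2N_ge0 (R : realType) (x : \bar R) : (0 <= exp2N x)%E.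
Proof. by case: x => [r| |] //=; rewrite lee_fin powR_ge0. Qed.

Lemma le_exp2N (R : realType) (x y : \bar R) : (x <= y)%E -> (exp2N y <= exp2N x)%E.
Proof.
case: y => [s| |]; case: x => [r| |] //= h; rewrite ?leey ?lee_fin ?powR_ge0 //.
by apply: ler_powR; rewrite ?ler1n // lerN2 -lee_fin.
Qed.

Lemma kappa_set0 (R : realType) n U : kappa R n U set0 = 0%E.
Proof.
rewrite /kappa /set_complexity (_ : [set _ | _ in _] = set0) ?ereal_inf0 //.
by apply/seteqP; split=> [_ [q [] //]|].
Qed.

Lemma kappa_ge0 (R : realType) n U E : (0 <= kappa R n U E)%E.
Proof. exact: exp2N_ge0. Qed.

Lemma kappa_le1 (R : realType) n U E : (kappa R n U E <= 1)%E.
Proof.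
rewrite /kappa; have [->|[k ->]] := set_complexity_nat U E; first exact: lee01.
by rewrite lee_fin -[leRHS](powRr0 2) ler_powR ?ler1n // oppr_le0.
Qed.

Lemma le_kappa (R : realType) n U :
  {homo kappa R n U : A B / (A `<=` B)%classic >-> (A <= B)%E}.
Proof.
move=> A B AB; apply/le_exp2N/ereal_inf_le_tmp => _ [q Aq <-].
by exists q => //; exact: AB.
Qed.

Lemma kappa_sigma_subadditive (R : realType) n U : sigma_subadditive (kappa R n U).
Proof.
move=> F; have sum_ge0 : (0 <= \sum_(i <oo) kappa R n U (F i))%E.
  by apply: nneseries_ge0 => i _ _; exact: kappa_ge0.
set S := [set vec_complexity R U q | q in
  [set q | (\bigcup_n0 F n0) (ratvec R q)]].
have [S0|/set0P S0] := eqVneq S set0.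
  by rewrite {1}/kappa /set_complexity -/S S0 ereal_inf0.
have [q [i _ Fiq] Kq] : S (ereal_inf S).
  apply: (ereal_inf_nat_attained _ S0) => _ [q _ <-].
  exact: vec_complexity_nat.
have le_i : (kappa R n U (\bigcup_n F n) <= kappa R n U (F i))%E.
  by apply: le_exp2N; rewrite /set_complexity -/S -Kq; apply: ereal_inf_lbound; exists q.
apply: (le_trans le_i); apply: (@le_trans _ _ (\sum_(0 <= j < i.+1) kappa R n U (F j))%E).
  by rewrite big_nat_recr //= leeDr // sume_ge0 // => j _; exact: kappa_ge0.
by apply: nneseries_lim_ge => j _ _; exact: kappa_ge0.
Qed.

HB.instance Definition _ (R : realType) (n : nat) (U : turing_machine) :=
  isOuterMeasure.Build R 'rV[R]_n (kappa R n U) (@kappa_set0 R n U)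
    (@kappa_ge0 R n U) (@le_kappa R n U) (@kappa_sigma_subadditive R n U).

(* Main.v *)
(** Point masses of kappa are [2^-|p|] for shortest programs [p] of distinct
    points, so Kraft's inequality bounds their sum by 1, and running ever more
    programs of [U] for ever more steps approximates kappa from below.

    Now let nu be strongly finite and lower semicomputable, with total point mass
    [C].  The cubes of level [r] are disjoint, so their nu-measures add up to at
    most [C], and a strict lower bound on nu(Q) is confirmed by a computation on
    finitely many rational points of Q.  Request a codeword of length about
    [k + c] for each confirmed [nu(Q_m^(r)) > (r+1)(r+2) 2^-k].  Since the sum of
    [1/((r+1)(r+2))] is 1, the Kraft sum of all requests is at most [2 C 2^-c],
    hence at most 1 for large [c].  A Kraft-Chaitin prefix machine then describes
    a rational point of [Q_m^(r)] by such a codeword, and universality of [U]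
    gives [kappa(Q) >= const * nu(Q) / ((r+1)(r+2))].

    Turing machines are built from counter programs.  The functions on naturals
    that these compute are closed under composition, pairing and iteration, and
    they include the step-bounded simulation of an arbitrary Turing machine. *)

From Corelib Require PosDef.
From Stdlib Require Import BinNums.
Require Import Defs.
From mathcomp Require Import all_boot all_order all_algebra.
From mathcomp Require Import finmap zify ring lra.
From mathcomp Require Import all_classical all_reals all_analysis.

Set Implicit Arguments.
Unset Strict Implicit.
Unset Printing Implicit Defensive.

(** * Counter programs and their compilation to Turing machines *)

(** An outer measure need not be additive, so disjointness of the cubes alone does not bound the sum
    of their measures. Strong finiteness repairs this: subadditivity bounds the measure of a finite
    set of rational points by the sum of its point masses, and point masses do add up over disjoint
    cubes. Finite support brings a cube with infinitely many rational points down to such finite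
    sets. All levels share one machine, because universality costs a constant per machine and that
    constant must not depend on the level; this forces the weights, whose logarithm is the only loss
    that grows with the level. On one cube the requests for all exponents [k] cost a geometric sum,
    whence the factor 2.

    On the machine side the delicate point is divergence: the Kraft machine is prefix-free only if
    it halts on codewords alone, so a failing search must be shown never to halt. Encoded data are
    never parsed; a search runs through all codes until one encodes to the given string, so only the
    encoders have to be computable, and their injectivity makes the answer right. *)

Record store := Store { io : tape unit; reg : nat -> nat }.

Inductive test := RegPos of nat | HeadIsBit | HeadIsOne.

Inductive prog :=
  | Inc of nat
  | Dec of nat
  | Put of cell unit & direction
  | Seq of prog & prog
  | If of test & prog & prog
  | While of test & prog.

Definition upd (s : store) (i v : nat) : store :=
  Store (io s) (fun j => if j == i then v else reg s j).

Definition is_bit (a : cell unit) : bool :=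
  if a is Some (inl _) then true else false.

Definition is_one (a : cell unit) : bool :=
  if a is Some (inl true) then true else false.

Definition eval (t : test) (s : store) : bool :=
  match t with
  | RegPos i => 0 < reg s i
  | HeadIsBit => is_bit (tape_head (io s))
  | HeadIsOne => is_one (tape_head (io s))
  end.

Inductive exec : prog -> store -> store -> Prop :=
  | ExecInc i s : exec (Inc i) s (upd s i (reg s i).+1)
  | ExecDec i s : exec (Dec i) s (upd s i (reg s i).-1)
  | ExecPut a d s : exec (Put a d) s (Store (write_move (io s) (a, d)) (reg s))
  | ExecSeq p q s1 s2 s3 :
      exec p s1 s2 -> exec q s2 s3 -> exec (Seq p q) s1 s3
  | ExecIf t p q s1 s2 :
      exec (if eval t s1 then p else q) s1 s2 -> exec (If t p q) s1 s2
  | ExecWhileStop t p s : eval t s = false -> exec (While t p) s s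
  | ExecWhileStep t p s1 s2 s3 :
      eval t s1 -> exec p s1 s2 -> exec (While t p) s2 s3 ->
      exec (While t p) s1 s3.

Fixpoint reg_bound (p : prog) : nat :=
  let test_bound t := if t is RegPos i then i.+1 else 0 in
  match p with
  | Inc i | Dec i => i.+1
  | Put _ _ => 0
  | Seq p q => maxn (reg_bound p) (reg_bound q)
  | If t p q => maxn (test_bound t) (maxn (reg_bound p) (reg_bound q))
  | While t p => maxn (test_bound t) (reg_bound p)
  end.

Definition marker : cell unit := Some (inr tt).

(* Register [i] is held by tape [i.+1], as the distance of its head from a cell
   carrying [marker]; all other cells of the tape are blank. *)
Definition counter_tape (v k : nat) : tape unit :=
  if v is v'.+1 then
    Tape (nseq v' None ++ [:: marker]) None (nseq k None)
  else Tape [::] marker (nseq k None).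

Section Compile.
Variable N : nat.

Notation heads := {ffun 'I_N.+1 -> cell unit}.
Notation tapes := {ffun 'I_N.+1 -> tape unit}.
Notation action := ('I_N.+1 -> cell unit * direction).

Definition reg_tape (i : nat) : 'I_N.+1 := inord i.+1.

(** The blanks listed right of the head are traces of earlier moves, which the register value does
    not determine; hence the existential [k]. *)
Definition holds (s : store) (T : tapes) : Prop :=
  T ord0 = io s /\
  forall i, i < N -> exists k, T (reg_tape i) = counter_tape (reg s i) k.

Definition head_test (t : test) (h : heads) : bool :=
  match t with
  | RegPos i => h (reg_tape i) != marker
  | HeadIsBit => is_bit (h ord0)
  | HeadIsOne => is_one (h ord0)
  end.

Definition act_on (h : heads) (i : 'I_N.+1) (x : cell unit * direction) : action :=
  fun j => if j == i then x else (h j, Stay).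

Definition no_act (h : heads) : action := fun j => (h j, Stay).

(** The extra state [None] of [If] and [While] is the one in which the test is evaluated, at the
    cost of one step. *)
Fixpoint state (p : prog) : finType :=
  match p with
  | Inc _ | Dec _ | Put _ _ => unit
  | Seq p q => (state p + state q)%type
  | If _ p q => option (state p + state q)
  | While _ p => option (state p)
  end.

Fixpoint start (p : prog) : state p :=
  match p with
  | Inc _ | Dec _ | Put _ _ => tt
  | Seq p q => inl (start p)
  | If _ _ _ | While _ _ => None
  end.

(* The successor state [None] means that the program has terminated. *)
Fixpoint delta (p : prog) : state p -> heads -> option (state p) * action :=
  match p with
  | Inc i => fun _ h => (None, act_on h (reg_tape i) (h (reg_tape i), MoveR))
  | Dec i => fun _ h =>
      (None, act_on h (reg_tape i)
        (h (reg_tape i), if h (reg_tape i) == marker then Stay else MoveL))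
  | Put a d => fun _ h => (None, act_on h ord0 (a, d))
  | Seq p q => fun x h =>
      match x with
      | inl x => let: (o, a) := delta x h in
          (Some (if o is Some y then inl y else inr (start q)), a)
      | inr x => let: (o, a) := delta x h in (omap inr o, a)
      end
  | If t p q => fun x h =>
      match x with
      | None => (Some (Some (if head_test t h then inl (start p)
                             else inr (start q))), no_act h)
      | Some (inl x) => let: (o, a) := delta x h in (omap (Some \o inl) o, a)
      | Some (inr x) => let: (o, a) := delta x h in (omap (Some \o inr) o, a)
      end
  | While t p => fun x h =>
      match x with
      | None => (if head_test t h then Some (Some (start p)) else None, no_act h)
      | Some x => let: (o, a) := delta x h in (Some o, a)
      end
  end.

Definition read (T : tapes) : heads := [ffun i => tape_head (T i)].
Definition act (T : tapes) (a : action) : tapes :=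
  [ffun i => write_move (T i) (a i)].

(** [D] is total because a fragment inside a larger machine hands over control instead of halting;
    the exact number of steps serves the divergence proof. *)
Inductive goes (Q : Type) (D : Q -> heads -> Q * action) :
    nat -> Q * tapes -> Q * tapes -> Prop :=
  | GoesRefl c : goes D 0 c c
  | GoesStep k x T c :
      goes D k ((D x (read T)).1, act T (D x (read T)).2) c ->
      goes D k.+1 (x, T) c.

Lemma goes_trans Q (D : Q -> heads -> Q * action) k l c1 c2 c3 :
  goes D k c1 c2 -> goes D l c2 c3 -> goes D (k + l) c1 c3.
Proof. by elim=> // {}k x T c _ IH /IH; exact: GoesStep. Qed.

Lemma write_move_stay (G : finType) (t : tape G) :
  write_move t (tape_head t, Stay) = t.
Proof. by case: t. Qed.

Lemma act_no_act T : act T (no_act (read T)) = T.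
Proof. by apply/ffunP => i; rewrite ffunE /no_act ffunE write_move_stay. Qed.

Lemma act_act_on T i x j :
  act T (act_on (read T) i x) j = if j == i then write_move (T i) x else T j.
Proof.
by rewrite ffunE /act_on; case: eqP => [->//|_]; rewrite ffunE write_move_stay.
Qed.

Lemma reg_tape_neq0 i : i < N -> (ord0 == reg_tape i) = false.
Proof. by move=> iN; apply/eqP => /(congr1 val); rewrite /= inordK. Qed.

Lemma reg_tape_eq i j : i < N -> j < N -> (reg_tape i == reg_tape j) = (i == j).
Proof. by move=> iN jN; rewrite -val_eqE /= !inordK. Qed.

Lemma counter_tape_head v k : (tape_head (counter_tape v k) != marker) = (0 < v).
Proof. by case: v. Qed.

Lemma counter_tape_inc v k : exists k',
  write_move (counter_tape v k) (tape_head (counter_tape v k), MoveR) =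
  counter_tape v.+1 k'.
Proof.
by exists k.-1; case: v => [|v] /=; case: k.
Qed.

Lemma counter_tape_dec v k : exists k',
  write_move (counter_tape v k) (tape_head (counter_tape v k),
    if tape_head (counter_tape v k) == marker then Stay else MoveL) =
  counter_tape v.-1 k'.
Proof.
case: v => [|[|v]] /=; first by exists k.
- by exists k.+1.
- by exists k.+1.
Qed.

Lemma holds_upd s T i v k (x : cell unit * direction) :
  i < N -> holds s T -> write_move (T (reg_tape i)) x = counter_tape v k ->
  holds (upd s i v) (act T (act_on (read T) (reg_tape i) x)).
Proof.
move=> iN [T0 Ti] E; split; first by rewrite act_act_on reg_tape_neq0.
move=> j jN; rewrite act_act_on reg_tape_eq //=.
by case: eqP => [_|_]; [exists k | exact: Ti].
Qed.

(** The program [While t (Put None Stay)] appears only for its register bound, which is exactly that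
    of the test [t]. *)
Lemma eval_read t s T : reg_bound (While t (Put None Stay)) <= N ->
  holds s T -> head_test t (read T) = eval t s.
Proof.
rewrite /= maxn0 => tN [T0 Ti]; case: t tN => [i iN||_] /=.
- by rewrite ffunE; have [k ->] := Ti i iN; rewrite counter_tape_head.
- by rewrite ffunE T0.
- by rewrite ffunE T0.
Qed.

(* [f] embeds the states of [p] in a larger machine [D], which continues in
   state [e] when [p] terminates. *)
Definition embeds (Q : Type) (D : Q -> heads -> Q * action) (p : prog)
    (f : state p -> Q) (e : Q) : Prop :=
  forall x h, D (f x) h = (if (delta x h).1 is Some y then f y else e, (delta x h).2).
Arguments embeds {Q} D p f e.

(** The machine, the embedding and the exit state stay general in the induction: the body of a loop
    runs inside the same machine with the testing state [f None] as its exit. *)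
Lemma exec_goes p s s' : exec p s s' ->
  forall Q (D : Q -> heads -> Q * action) f e, embeds D p f e ->
  forall T, reg_bound p <= N -> holds s T ->
  exists k T', holds s' T' /\ goes D k (f (start p), T) (e, T').
Proof.
elim=> {p s s'} [i s|i s|a d s|p q s1 s2 s3 _ IHp _ IHq|t p q s1 s2 _ IH|t p s tF|
    t p s1 s2 s3 t1 _ IHp _ IHw] Q D f e emb T /= bN hT.
- have [_ Ti] := hT; have [k Tk] := Ti i bN.
  have [k' Ek] := counter_tape_inc (reg s i) k.
  exists 1; eexists; split; last first.
    by apply: GoesStep; rewrite emb /=; exact: GoesRefl.
  by apply: (holds_upd (k := k')) => //; rewrite /read ffunE Tk.
- have [_ Ti] := hT; have [k Tk] := Ti i bN.
  have [k' Ek] := counter_tape_dec (reg s i) k.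
  exists 1; eexists; split; last first.
    by apply: GoesStep; rewrite emb /=; exact: GoesRefl.
  by apply: (holds_upd (k := k')) => //; rewrite /read ffunE Tk.
- exists 1; eexists; split; last first.
    by apply: GoesStep; rewrite emb /=; exact: GoesRefl.
  case: hT => T0 Ti; split=> [|i iN]; rewrite act_act_on; first by rewrite eqxx T0.
  by rewrite eq_sym reg_tape_neq0 //; exact: Ti.
- move: bN; rewrite geq_max => /andP[pN qN].
  have [|k [T1 [h1 g1]]] := IHp Q D (f \o inl) (f (inr (start q))) _ T pN hT.
    by move=> x h; rewrite emb /=; case: (delta x h) => [[y|] a].
  have [|l [T2 [h2 g2]]] := IHq Q D (f \o inr) e _ T1 qN h1.
    by move=> x h; rewrite emb /=; case: (delta x h) => [[y|] a].
  by exists (k + l), T2; split=> //; exact: goes_trans g1 g2.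
- move: bN; rewrite !geq_max => /and3P[tN pN qN].
  have Et : head_test t (read T) = eval t s1 by apply: eval_read; rewrite //= maxn0.
  suff [k [T2 [h2 g2]]] : exists k T2, holds s2 T2 /\
      goes D k (f (Some (if eval t s1 then inl (start p) else inr (start q))), T)
        (e, T2).
    by exists k.+1, T2; split=> //; apply: GoesStep; rewrite emb /= act_no_act Et.
  case: (eval t s1) IH => IH.
    apply: (IH Q D (f \o Some \o inl)) => // x h.
    by rewrite emb /=; case: (delta x h) => [[y|] a].
  apply: (IH Q D (f \o Some \o inr)) => // x h.
  by rewrite emb /=; case: (delta x h) => [[y|] a].
- move: bN; rewrite !geq_max => /andP[tN pN].
  have Et : head_test t (read T) = false by rewrite -tF; apply: eval_read; rewrite //= maxn0.
  exists 1, T; split=> //; apply: GoesStep; rewrite emb /= act_no_act Et /=.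
  exact: GoesRefl.
- have := bN; rewrite !geq_max => /andP[tN pN].
  have Et : head_test t (read T) = true by rewrite -t1; apply: eval_read; rewrite //= maxn0.
  have [|k [T1 [h1 g1]]] := IHp Q D (f \o Some) (f None) _ T pN hT.
    by move=> x h; rewrite emb /=; case: (delta x h) => [[y|] a].
  have [l [T2 [h2 g2]]] := IHw Q D f e emb T1 bN h1.
  exists (k + l).+1, T2; split=> //; apply: GoesStep; rewrite emb /= act_no_act Et /=.
  exact: goes_trans g1 g2.
Qed.

End Compile.
Arguments embeds {N Q} D p f e.

(** * Halting and divergence of compiled programs *)

Section ProgramMachine.
Variable P : prog.

Notation N := (reg_bound P).
Notation heads := {ffun 'I_N.+1 -> cell unit}.

(* [None] is the initial state, which writes the markers, [Some None] the final
   state. *)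
Definition prog_delta (q : option (option (state P))) (h : heads) :
    option (option (option (state P)) * ('I_N.+1 -> cell unit * direction)) :=
  match q with
  | None => Some (Some (Some (start P)),
      fun i => (if i == ord0 then h i else marker, Stay))
  | Some None => None
  | Some (Some x) => let: (o, a) := delta x h in Some (Some o, a)
  end.

Definition prog_machine : turing_machine :=
  @TuringMachine N unit (option (option (state P))) None prog_delta.

(** Idling in the final state makes the step total, so a [goes] run may extend past the halt. *)
Definition prog_step (q : tm_state prog_machine) (h : heads) :=
  if prog_delta q h is Some r then r else (q, no_act h).

Definition init_store (w : bitstring) : store :=
  Store (string_tape unit w) (fun=> 0).

Lemma prog_embeds : embeds prog_step P (Some \o Some) (Some None).
Proof. by move=> x h; rewrite /prog_step /=; case: (delta x h) => [[y|] a]. Qed.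

Lemma init_goes w : exists T, holds (init_store w) T /\
  goes prog_step 1 (tm_init prog_machine w) (Some (Some (start P)), T).
Proof.
eexists; split; last by apply: GoesStep; exact: GoesRefl.
split=> [|i iN]; rewrite !ffunE /=; first by rewrite /read !ffunE eqxx.
by exists 0; rewrite eq_sym reg_tape_neq0.
Qed.

Lemma run_of_goes k (c c' : tm_config prog_machine) :
  goes prog_step k c c' -> tm_step c' = None ->
  exists j, tm_run j c = Some c'.
Proof.
elim=> {k c c'} [c|k x T c g IH] H; first by exists 0; rewrite /= H.
have [j Ej] := IH H.
case E: (prog_delta x (read T)) => [[q a]|].
  exists j.+1; rewrite /= /tm_step /= -[ [ffun i => _] ]/(read T) E.
  by move: Ej; rewrite /prog_step E.
exists j; move: Ej; rewrite /prog_step E /= act_no_act; exact.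
Qed.

(** Determinism, together with the fact that idling leaves a halted configuration unchanged. *)
Lemma goes_past_halt j (c c1 : tm_config prog_machine) : tm_run j c = Some c1 ->
  forall k c', j <= k -> goes prog_step k c c' -> c' = c1.
Proof.
have stuck (c2 : tm_config prog_machine) k c' : tm_step c2 = None ->
    goes prog_step k c2 c' -> c' = c2.
  move=> + g; elim: g => {k c2 c'} // k x T c2 _ IH H.
  have E : prog_delta x (read T) = None.
    by move: H; rewrite /tm_step /= -[ [ffun i => _] ]/(read T); case: prog_delta => // -[].
  by move: IH; rewrite /prog_step E /= act_no_act; apply.
elim: j c => [|j IH] c /=.
  case E: (tm_step c) => [//|] [<-] k c' _; exact: stuck.
case E: (tm_step c) => [c2|] // H k c' jk g; last first.
  by case: H g => <-; exact: stuck.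
case: g E jk => // l x T c3 g E jk.
apply: (IH c2 H l c3 jk); move: E g.
rewrite /tm_step /= -[ [ffun i => _] ]/(read T) /prog_step.
by case: prog_delta => // -[q a] [<-].
Qed.

Lemma prog_machine_halts w s : exec P (init_store w) s ->
  computes prog_machine w (leading_bits (tape_head (io s) :: tape_right (io s))).
Proof.
move=> ex; have [T [hT g0]] := init_goes w.
have [k [T1 [h1 g1]]] := exec_goes ex prog_embeds (leqnn _) hT.
have [//|j Ej] := run_of_goes (goes_trans g0 g1) _.
by exists j; eexists; split; [exact: Ej|]; rewrite /tm_output /= h1.1.
Qed.

End ProgramMachine.

(** For every [m] the invariant [I] yields a run of at least [m] steps that ends at the test of the
    loop. If the machine halted, a long enough run of this kind would end in the halted
    configuration, yet the testing state always has a successor. *)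
Lemma prog_machine_diverges pre t body post (I : store -> Prop) w s :
  exec pre (init_store w) s -> I s ->
  (forall s, I s -> eval t s /\ exists2 s', exec body s s' & I s') ->
  ~ halting_set (prog_machine (Seq pre (Seq (While t body) post))) w.
Proof.
set P := Seq pre _ => ex Is loop [v [j [c1 [run _]]]].
have [T [hT g0]] := init_goes P w.
have : reg_bound P <= reg_bound P by [].
rewrite [X in X <= _]/= !geq_max => /and3P[preN /andP[tN bodyN] postN].
pose f x : tm_state (prog_machine P) := Some (Some x).
have [|k [T1 [h1 g1]]] := exec_goes ex (D := @prog_step P)
    (f := f \o inl) (e := f (inr (inl None))) _ preN hT.
  by move=> x h; rewrite /prog_step /=; case: (delta x h) => [[y|] a].
have along m : exists k T s, [/\ m <= k, I s, holds s T &
    goes (@prog_step P) k (tm_init (prog_machine P) w) (f (inr (inl None)), T)].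
  elim: m => [|m [k2 [T2 [s2 [mk I2 h2 g2]]]]].
    by exists (1 + k), T1, s; split => //; exact: goes_trans g0 g1.
  have [t2 [s3 ex3 I3]] := loop _ I2.
  have Et : head_test t (read T2) = true.
    by rewrite -t2; apply: eval_read h2; rewrite /= maxn0.
  have [|l [T3 [h3 g3]]] := exec_goes ex3 (D := @prog_step P)
      (f := f \o inr \o inl \o Some) (e := f (inr (inl None))) _ bodyN h2.
    by move=> x h; rewrite /prog_step /=; case: (delta x h) => [[y|] a].
  exists (k2 + l.+1), T3, s3; split => //; first by rewrite addnS ltnS (leq_trans mk) ?leq_addr.
  apply: goes_trans g2 _; apply: GoesStep.
  by rewrite /prog_step /= Et /= act_no_act.
have [k2 [T2 [s2 [jk _ _ g2]]]] := along j.
have E := goes_past_halt run jk g2.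
have : tm_step c1 = None.
  elim: (j) (tm_init _ _) run => [|i IH] c /=.
    by case E': (tm_step c) => [//|] [<-].
  by case E': (tm_step c) => [c2|]; [exact: IH | case=> <-].
by rewrite -E /tm_step /=; case: (head_test _ _).
Qed.

(** * Functions on naturals computed by counter programs *)

Fixpoint tri (n : nat) : nat := if n is m.+1 then n + tri m else 0.

Definition npair (a b : nat) : nat := b + tri (a + b).

(** One step along the antidiagonals of the Cantor enumeration; unpairing by iterating it spares the
    counter programs any division or root. *)
Definition next_pair (x : nat * nat) : nat * nat :=
  if x.1 is a.+1 then (a, x.2.+1) else (x.2.+1, 0).

Definition nunpair (n : nat) : nat * nat := iter n next_pair (0, 0).
Definition nfst n := (nunpair n).1.
Definition nsnd n := (nunpair n).2.

Lemma nunpairK a b : nunpair (npair a b) = (a, b).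
Proof.
have down k c d : iter k next_pair (k + c, d) = (c, k + d).
  elim: k d => // k IH d; by rewrite iterSr {2}/next_pair /= IH addnS.
have triE s : iter (tri s) next_pair (0, 0) = (s, 0).
  elim: s => // s IH; rewrite [tri _]/= iterD IH iterS.
  by have := down s 0 0; rewrite !addn0 => ->.
by rewrite /nunpair /npair iterD triE addnC down addn0.
Qed.

Lemma npairK1 a b : nfst (npair a b) = a. Proof. by rewrite /nfst nunpairK. Qed.
Lemma npairK2 a b : nsnd (npair a b) = b. Proof. by rewrite /nsnd nunpairK. Qed.

Lemma nunpair_le n : nfst n + nsnd n <= n.
Proof.
rewrite /nfst /nsnd /nunpair; elim: n => //= n.
by case: (iter _ _ _) => [[|a] b] /=; lia.
Qed.

Lemma nsnd_le n : nsnd n <= n.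
Proof. by apply: leq_trans (nunpair_le n); rewrite leq_addl. Qed.

(** * Stores and counted loops *)

Lemma storeP (s s' : store) : io s = io s' -> reg s =1 reg s' -> s = s'.
Proof. by case: s s' => [a f] [b g] /= -> /funext ->. Qed.

Lemma upd_upd s i v w : upd (upd s i v) i w = upd s i w.
Proof. by apply: storeP => //= j; case: eqP. Qed.

Lemma exec_eq p s s1 s2 : exec p s s1 -> s1 = s2 -> exec p s s2.
Proof. by move=> ? <-. Qed.

(** [S v] is the store at the moment the counter reads [v]; a closed form for it reduces a counted
    loop to equalities of stores. *)
Lemma exec_count i p (S : nat -> store) n s s' :
  s = S n -> s' = S 0 ->
  (forall v, v <= n -> reg (S v) i = v) ->
  (forall v, v < n -> exec p (S v.+1) (S v)) ->
  exec (While (RegPos i) p) s s'.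
Proof.
move=> -> ->; elim: n => [|n IH] Si step.
  by apply: ExecWhileStop; rewrite /= Si.
apply: ExecWhileStep (step n _) (IH _ _) => //; first by rewrite /= Si.
- by move=> v vn; apply: Si; exact: leqW.
- by move=> v vn; apply: step; exact: leqW.
Qed.

Ltac decide_regs := repeat (case: eqP => ?; try (by exfalso; lia)).
Ltac store_eq :=
  apply: storeP => [|?] //=; decide_regs; subst; try lia; try congruence.

Definition clear_reg i := While (RegPos i) (Dec i).
Definition move_reg i j := While (RegPos i) (Seq (Dec i) (Inc j)).
Definition copy_reg i j k := While (RegPos i) (Seq (Dec i) (Seq (Inc j) (Inc k))).

Lemma exec_clear i s : exec (clear_reg i) s (upd s i 0).
Proof.
apply: (exec_count (S := fun v => upd s i v) (n := reg s i)) => //= [|v _|v _].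
- by store_eq.
- by decide_regs.
- by apply: exec_eq (ExecDec _ _) _; store_eq.
Qed.

Lemma exec_move i j s : i <> j ->
  exec (move_reg i j) s (upd (upd s j (reg s j + reg s i)) i 0).
Proof.
move=> ij.
apply: (exec_count (S := fun v => upd (upd s j (reg s j + (reg s i - v))) i v)
  (n := reg s i)) => [|||v vn].
- by store_eq.
- by store_eq.
- by move=> v /=; decide_regs.
- by apply: ExecSeq (ExecDec _ _) _; apply: exec_eq (ExecInc _ _) _; store_eq.
Qed.

Lemma exec_copy i j k s : i <> j -> j <> k -> i <> k ->
  exec (copy_reg i j k) s
    (upd (upd (upd s j (reg s j + reg s i)) k (reg s k + reg s i)) i 0).
Proof.
move=> ij jk ik.
apply: (exec_count (S := fun v => upd (upd (upd s j (reg s j + (reg s i - v))) k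
  (reg s k + (reg s i - v))) i v) (n := reg s i)) => [|||v vn].
- by store_eq.
- by store_eq.
- by move=> v /=; decide_regs.
- apply: ExecSeq (ExecDec _ _) _; apply: ExecSeq (ExecInc _ _) _.
  by apply: exec_eq (ExecInc _ _) _; store_eq.
Qed.

Definition scratch_free (b : nat) (s : store) : Prop := forall j, b < j -> reg s j = 0.

Definition ncomp (f : nat -> nat) : Prop :=
  forall b, exists P, forall s, scratch_free b s -> exec P s (upd s b (f (reg s b))).

Lemma ncomp_ext f g : f =1 g -> ncomp f -> ncomp g.
Proof. by move=> /funext ->. Qed.

Lemma ncomp_succ : ncomp succn.
Proof. by move=> b; exists (Inc b) => s _; exact: ExecInc. Qed.

Lemma ncomp_pred : ncomp predn.
Proof. by move=> b; exists (Dec b) => s _; exact: ExecDec. Qed.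

Lemma ncomp_zero : ncomp (fun=> 0).
Proof. by move=> b; exists (clear_reg b) => s _; exact: exec_clear. Qed.

Lemma ncomp_comp f g : ncomp f -> ncomp g -> ncomp (f \o g).
Proof.
move=> cf cg b; have [P Pf] := cf b; have [Q Qg] := cg b.
exists (Seq Q P) => s sf; apply: ExecSeq (Qg s sf) _.
apply: exec_eq (Pf _ _) _; last by store_eq.
by move=> j bj /=; decide_regs; exact: sf.
Qed.

Lemma ncomp_id : ncomp id.
Proof. exact: (ncomp_ext _ (ncomp_comp ncomp_pred ncomp_succ)). Qed.

Lemma ncomp_const k : ncomp (fun=> k).
Proof.
by elim: k => [|k IH]; [exact: ncomp_zero | exact: (ncomp_comp ncomp_succ IH)].
Qed.

(** After the copy, register [b] holds the sum of the two arguments and [b.+2] the second one. Each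
    pass adds the current value of [b] to [b.+2] while [b] counts down, which contributes the
    triangular number. *)
Definition pair_regs b :=
  Seq (copy_reg b.+1 b b.+2)
    (Seq (While (RegPos b)
       (Seq (Dec b) (Seq (Inc b.+2) (Seq (copy_reg b b.+1 b.+2) (move_reg b.+1 b)))))
    (move_reg b.+2 b)).

Lemma exec_pair_regs b s : scratch_free b.+1 s ->
  exec (pair_regs b) s (upd (upd s b (npair (reg s b) (reg s b.+1))) b.+1 0).
Proof.
move=> sf; have s2 : reg s b.+2 = 0 by exact: sf.
apply: ExecSeq; first by apply: exec_copy; lia.
set A := reg s b + reg s b.+1.
apply: (@ExecSeq _ _ _ (upd (upd (upd s b 0) b.+1 0) b.+2
    (npair (reg s b) (reg s b.+1)))); last first.
  by apply: exec_eq (exec_move _ _) _; [lia | store_eq].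
apply: (exec_count (S := fun v => upd (upd (upd s b v) b.+1 0) b.+2
  (reg s b.+1 + (tri A - tri v))) (n := A)) => [|||v vA].
- by store_eq.
- by rewrite /npair -/A; store_eq; rewrite /=; lia.
- by move=> v /=; decide_regs.
(* Keeps the truncated difference [tri A - tri v] exact. *)
have triA : v.+1 + tri v <= tri A.
  by elim: A vA => // A IH; rewrite ltnS leq_eqVlt => /predU1P[->//|/IH /=]; lia.
apply: ExecSeq (ExecDec _ _) _; apply: ExecSeq (ExecInc _ _) _.
apply: ExecSeq; first by apply: exec_copy; lia.
apply: exec_eq (exec_move _ _) _; first by lia.
by store_eq.
Qed.

Definition unpair_regs b :=
  Seq (move_reg b b.+2)
    (While (RegPos b.+2)
      (Seq (Dec b.+2)
        (If (RegPos b) (Seq (Dec b) (Inc b.+1))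
          (Seq (Inc b) (move_reg b.+1 b))))).

Lemma exec_unpair_regs b s : scratch_free b s ->
  exec (unpair_regs b) s (upd (upd s b (nfst (reg s b))) b.+1 (nsnd (reg s b))).
Proof.
move=> sf; have s2 : reg s b.+2 = 0 by exact: sf.
have s1 : reg s b.+1 = 0 by exact: sf.
apply: ExecSeq; first by apply: exec_move; lia.
set n := reg s b.
apply: (exec_count (S := fun v => upd (upd (upd s b (nfst (n - v))) b.+1 (nsnd (n - v)))
  b.+2 v) (n := n)) => [|||v vn].
- by rewrite subnn; store_eq.
- by rewrite subn0; store_eq.
- by move=> v /=; decide_regs.
have E : nunpair (n - v) = next_pair (nunpair (n - v.+1)) by rewrite -(subnSK vn).
apply: ExecSeq (ExecDec _ _) _; apply: ExecIf.
rewrite /nfst /nsnd E; case: (nunpair (n - v.+1)) => [[|a] c] /=; decide_regs => /=.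
- apply: ExecSeq (ExecInc _ _) _; apply: exec_eq (exec_move _ _) _; first by lia.
  by store_eq.
- apply: ExecSeq (ExecDec _ _) _; apply: exec_eq (ExecInc _ _) _; store_eq.
Qed.

Lemma ncomp_fst : ncomp nfst.
Proof.
move=> b; exists (Seq (unpair_regs b) (clear_reg b.+1)) => s sf.
apply: ExecSeq (exec_unpair_regs sf) _; apply: exec_eq (exec_clear _ _) _.
by have s1 := sf b.+1 (leqnn _); store_eq.
Qed.

Lemma ncomp_snd : ncomp nsnd.
Proof.
move=> b; exists (Seq (unpair_regs b) (Seq (clear_reg b) (move_reg b.+1 b))) => s sf.
apply: ExecSeq (exec_unpair_regs sf) _; apply: ExecSeq (exec_clear _ _) _.
apply: exec_eq (exec_move _ _) _; first by lia.
by have s1 := sf b.+1 (leqnn _); store_eq.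
Qed.

Lemma ncomp_pair f g : ncomp f -> ncomp g -> ncomp (fun n => npair (f n) (g n)).
Proof.
move=> cf cg b; have [P Pf] := cf b.+1; have [Q Qg] := cg b.+2.
(* [P] runs at [b.+1] above the saved argument, [Q] at [b.+2] above the value of [f]; in both cases
   every register above the base is zero. *)
exists (Seq (copy_reg b b.+1 b.+2) (Seq (move_reg b.+2 b) (Seq P
  (Seq (move_reg b b.+2) (Seq Q (Seq (move_reg b.+1 b) (Seq (move_reg b.+2 b.+1)
  (pair_regs b)))))))) => s sf.
have s1 : reg s b.+1 = 0 by exact: sf.
have s2 : reg s b.+2 = 0 by exact: sf.
set n := reg s b.
apply: ExecSeq; first by apply: exec_copy; lia.
apply: ExecSeq; first by apply: exec_move; lia.
apply: (@ExecSeq _ _ _ (upd s b.+1 (f n))).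
  apply: exec_eq (Pf _ _) _; last by store_eq; rewrite ?s1 ?add0n.
  by move=> j bj /=; decide_regs => //; apply: sf; lia.
apply: ExecSeq; first by apply: exec_move; lia.
apply: (@ExecSeq _ _ _ (upd (upd (upd s b 0) b.+1 (f n)) b.+2 (g n))).
  apply: exec_eq (Qg _ _) _; last by store_eq; rewrite ?s2 ?add0n.
  by move=> j bj /=; decide_regs => //; apply: sf; lia.
apply: ExecSeq; first by apply: exec_move; lia.
apply: ExecSeq; first by apply: exec_move; lia.
apply: exec_eq (exec_pair_regs _) _.
  by move=> j bj /=; decide_regs => //; apply: sf; lia.
by store_eq; rewrite !add0n.
Qed.

Lemma ncomp_iter f : ncomp f -> ncomp (fun n => iter (nfst n) f (nsnd n)).
Proof.
move=> cf b; have [P Pf] := cf b.+1.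
exists (Seq (unpair_regs b) (Seq (While (RegPos b) (Seq (Dec b) P))
  (move_reg b.+1 b))) => s sf.
have s1 : reg s b.+1 = 0 by exact: sf.
apply: ExecSeq (exec_unpair_regs sf) _; set n := reg s b.
apply: (@ExecSeq _ _ _ (upd (upd s b 0) b.+1 (iter (nfst n) f (nsnd n)))); last first.
  by apply: exec_eq (exec_move _ _) _; [lia | store_eq].
apply: (exec_count (S := fun v => upd (upd s b v) b.+1
  (iter (nfst n - v) f (nsnd n))) (n := nfst n)) => [|||v vn].
- by rewrite subnn; store_eq.
- by rewrite subn0; store_eq.
- by move=> v /=; decide_regs.
apply: ExecSeq (ExecDec _ _) _; apply: exec_eq (Pf _ _) _.
  by move=> j bj /=; decide_regs => //; apply: sf; lia.
by rewrite -(subnSK vn); store_eq.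
Qed.

(** * Computable functions on represented types *)

(** A conditional made from iteration: the step copies the first component of a pair over the
    second, so zero steps leave [h n] there and any positive number of steps leaves [g n]. *)
Lemma ncomp_ifz f g h : ncomp f -> ncomp g -> ncomp h ->
  ncomp (fun n => if f n is 0 then h n else g n).
Proof.
move=> cf cg ch.
apply: (@ncomp_ext (fun n => nsnd (iter (nfst (npair (f n) (npair (g n) (h n))))
    (fun s => npair (nfst s) (nfst s)) (nsnd (npair (f n) (npair (g n) (h n))))))).
  move=> n; rewrite npairK1 npairK2; case: (f n) => [|k] /=; first by rewrite npairK2.
  rewrite npairK2; set it := iter _ _ _; suff: nfst it = g n by [].
  by rewrite /it {it}; elim: k => [|k IH] /=; rewrite npairK1.
apply: (ncomp_comp ncomp_snd); apply: (ncomp_comp (ncomp_iter _)).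
  by apply: ncomp_pair; exact: ncomp_fst.
by do 2 apply: ncomp_pair => //.
Qed.

Fixpoint dec_list_fuel (k n : nat) : seq nat :=
  if k is k'.+1 then
    if n is m.+1 then nfst m :: dec_list_fuel k' (nsnd m) else [::]
  else [::].

Definition dec_list (n : nat) : seq nat := dec_list_fuel n n.

Definition enc_list : seq nat -> nat := foldr (fun a n => (npair a n).+1) 0.

Lemma dec_listS m : dec_list m.+1 = nfst m :: dec_list (nsnd m).
Proof.
have fuel k n : n <= k -> dec_list_fuel k n = dec_list_fuel n n.
  have [j] := ubnP k; elim: j k n => // j IH k n.
  case: n => [|n]; first by case: k.
  case: k => // k kj nk /=; rewrite ltnS in nk; have sn := nsnd_le n.
  by rewrite (IH k) ?(IH n) //; lia.
by rewrite /dec_list [LHS]/= fuel // nsnd_le.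
Qed.

Lemma enc_listK : cancel enc_list dec_list.
Proof. by elim=> //= a s IH; rewrite dec_listS npairK1 npairK2 IH. Qed.

Lemma size_dec_list n : size (dec_list n) <= n.
Proof.
have [j] := ubnP n; elim: j n => // j IH [|n] // nj; rewrite dec_listS /=.
by have := nsnd_le n; have := IH (nsnd n); lia.
Qed.

(* A represented type is a quotient of [nat]: codes need not be unique. *)
Class rep (A : Type) := Rep { dec : nat -> A; enc : A -> nat; encK : cancel enc dec }.

Instance rep_nat : rep nat := @Rep nat id id (fun=> erefl).

Lemma enc_boolK : cancel nat_of_bool (leq 1). Proof. by case. Qed.
Instance rep_bool : rep bool := Rep enc_boolK.

Lemma enc_prodK A B (rA : rep A) (rB : rep B) :
  cancel (fun x : A * B => npair (enc x.1) (enc x.2))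
    (fun n => (dec (nfst n), dec (nsnd n))).
Proof. by case=> a b /=; rewrite npairK1 npairK2 !encK. Qed.
Instance rep_prod A B (rA : rep A) (rB : rep B) : rep (A * B) := Rep (@enc_prodK A B rA rB).

Lemma enc_optionK A (rA : rep A) :
  cancel (fun x : option A => if x is Some a then (enc a).+1 else 0)
    (fun n => if n is m.+1 then Some (dec m) else None).
Proof. by case=> //= a; rewrite encK. Qed.
Instance rep_option A (rA : rep A) : rep (option A) := Rep (@enc_optionK A rA).

Lemma enc_seqK A (rA : rep A) :
  cancel (fun s : seq A => enc_list (map enc s)) (fun n => map dec (dec_list n)).
Proof. by move=> s; rewrite enc_listK mapK //; exact: encK. Qed.
Instance rep_seq A (rA : rep A) : rep (seq A) := Rep (@enc_seqK A rA).

Lemma dec_cons A (rA : rep A) m :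
  dec m.+1 = dec (nfst m) :: dec (nsnd m) :> seq A.
Proof. by rewrite -[LHS]/(map dec (dec_list m.+1)) dec_listS. Qed.

Lemma rep_canK A B (rA : rep A) (f : B -> A) (g : A -> B) :
  cancel f g -> cancel (enc \o f) (g \o dec).
Proof. by move=> fK b /=; rewrite encK. Qed.
Definition rep_can A B (rA : rep A) (f : B -> A) (g : A -> B) (fK : cancel f g) : rep B :=
  Rep (rep_canK rA fK).

(** The realizer only has to be right after decoding; different codes of one value may be sent to
    different codes. *)
Definition cmp A B {rA : rep A} {rB : rep B} (f : A -> B) : Prop :=
  exists2 F, ncomp F & forall n, dec (F n) = f (dec n).

Section Basic.
Context {A B C X : Type} {rA : rep A} {rB : rep B} {rC : rep C} {rX : rep X}.

Lemma cmp_ext (f g : A -> B) : f =1 g -> cmp f -> cmp g.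
Proof. by move=> /funext ->. Qed.

Lemma cmp_id : cmp (fun x : A => x).
Proof. by exists id => //; exact: ncomp_id. Qed.

Lemma cmp_const (b : B) : cmp (fun _ : A => b).
Proof. by exists (fun=> enc b) => [|n]; [exact: ncomp_const | exact: encK]. Qed.

Lemma cmp_comp (f : B -> C) (g : A -> B) : cmp f -> cmp g -> cmp (fun x => f (g x)).
Proof.
move=> [F cF Ff] [G cG Gg]; exists (F \o G); first exact: ncomp_comp.
by move=> n /=; rewrite Ff Gg.
Qed.

Lemma cmp_pair (f : X -> A) (g : X -> B) : cmp f -> cmp g -> cmp (fun x => (f x, g x)).
Proof.
move=> [F cF Ff] [G cG Gg]; exists (fun n => npair (F n) (G n)); first exact: ncomp_pair.
by move=> n /=; rewrite npairK1 npairK2 Ff Gg.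
Qed.

Lemma cmp_fst (f : X -> A * B) : cmp f -> cmp (fun x => (f x).1).
Proof.
move=> [F cF Ff]; exists (nfst \o F); first exact: ncomp_comp ncomp_fst cF.
by move=> n; rewrite -Ff.
Qed.

Lemma cmp_snd (f : X -> A * B) : cmp f -> cmp (fun x => (f x).2).
Proof.
move=> [F cF Ff]; exists (nsnd \o F); first exact: ncomp_comp ncomp_snd cF.
by move=> n; rewrite -Ff.
Qed.

Lemma cmp_if (c : X -> bool) (f g : X -> A) : cmp c -> cmp f -> cmp g ->
  cmp (fun x => if c x then f x else g x).
Proof.
move=> [K cK Kc] [F cF Ff] [G cG Gg].
exists (fun n => if K n is 0 then G n else F n); first exact: ncomp_ifz.
by move=> n; rewrite -Kc /=; case: (K n) => [|k] /=.
Qed.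

Lemma cmp_some (f : X -> A) : cmp f -> cmp (fun x => Some (f x)).
Proof.
move=> [F cF Ff]; exists (succn \o F); first exact: ncomp_comp ncomp_succ cF.
by move=> n; rewrite -Ff.
Qed.

Lemma cmp_opt (o : X -> option A) (f : X -> A -> B) (g : X -> B) :
  cmp o -> cmp (fun y : X * A => f y.1 y.2) -> cmp g ->
  cmp (fun x => if o x is Some a then f x a else g x).
Proof.
move=> [K cK Kc] [F cF Ff] [G cG Gg].
exists (fun n => if K n is 0 then G n else F (npair n (K n).-1)).
  apply: ncomp_ifz => //; apply: (ncomp_comp cF); apply: ncomp_pair; first exact: ncomp_id.
  exact: ncomp_comp ncomp_pred cK.
move=> n; rewrite -Kc /=; case: (K n) => [|k] /=; first exact: Gg.
by rewrite Ff /= npairK1 npairK2.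
Qed.

Lemma cmp_cons (f : X -> A) (g : X -> seq A) : cmp f -> cmp g ->
  cmp (fun x => f x :: g x).
Proof.
move=> [F cF Ff] [G cG Gg]; exists (fun n => (npair (F n) (G n)).+1).
  by apply: (ncomp_comp ncomp_succ); exact: ncomp_pair.
by move=> n; rewrite dec_cons npairK1 npairK2 Ff Gg.
Qed.

Lemma cmp_uncons (s : X -> seq A) (f : X -> A -> seq A -> B) (g : X -> B) :
  cmp s -> cmp (fun y : X * (A * seq A) => f y.1 y.2.1 y.2.2) -> cmp g ->
  cmp (fun x => if s x is a :: r then f x a r else g x).
Proof.
move=> [K cK Kc] [F cF Ff] [G cG Gg].
exists (fun n => if K n is 0 then G n else F (npair n (K n).-1)).
  apply: ncomp_ifz => //; apply: (ncomp_comp cF); apply: ncomp_pair; first exact: ncomp_id.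
  exact: ncomp_comp ncomp_pred cK.
move=> n; rewrite -Kc; case: (K n) => [|k]; first exact: Gg.
by rewrite dec_cons Ff /= npairK1 npairK2.
Qed.

(** The number of steps may depend on the code of the argument and not only on its value. Folds
    exploit this by taking the code of a list as a bound on its length. *)
Lemma cmp_iter_code (N : nat -> nat) (g : X -> B -> B) (b : X -> B) :
  ncomp N -> cmp (fun y : X * B => g y.1 y.2) -> cmp b ->
  exists2 F, ncomp F & forall n, dec (F n) = iter (N n) (g (dec n)) (b (dec n)).
Proof.
move=> cN [G cG Gg] [K cK Kb].
pose step s := npair (nfst s) (G s).
exists (fun n => nsnd (iter (nfst (npair (N n) (npair n (K n)))) step
    (nsnd (npair (N n) (npair n (K n)))))).
  apply: (ncomp_comp ncomp_snd); apply: (ncomp_comp (ncomp_iter _)).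
    by apply: ncomp_pair => //; exact: ncomp_fst.
  by do 2 apply: ncomp_pair => //; exact: ncomp_id.
move=> n; rewrite npairK1 npairK2.
have inv : let s := iter (N n) step (npair n (K n)) in
    nfst s = n /\ dec (nsnd s) = iter (N n) (g (dec n)) (b (dec n)); last by case: inv.
elim: (N n) => [|k [IH1 IH2]] /=; first by rewrite npairK1 npairK2 Kb.
by rewrite npairK1 npairK2 Gg /= IH1 IH2.
Qed.

Lemma cmp_iter (k : X -> nat) (g : X -> B -> B) (b : X -> B) :
  cmp k -> cmp (fun y : X * B => g y.1 y.2) -> cmp b ->
  cmp (fun x => iter (k x) (g x) (b x)).
Proof.
move=> [N cN Nk] cg cb; have [F cF Fg] := cmp_iter_code cN cg cb.
by exists F => // n; rewrite Fg -Nk.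
Qed.

End Basic.

Section Fold.
Context {A B X : Type} {rA : rep A} {rB : rep B} {rX : rep X}.

Lemma cmp_foldl (g : X -> B -> A -> B) (b : X -> B) (s : X -> seq A) :
  cmp (fun y : X * (B * A) => g y.1 y.2.1 y.2.2) -> cmp b -> cmp s ->
  cmp (fun x => foldl (g x) (b x) (s x)).
Proof.
move=> cg cb cs; have [N cN Ns] := cs.
(* An exhausted list is a fixed point of [step], so surplus iterations do no harm. *)
pose step x (t : B * seq A) := if t.2 is a :: r then (g x t.1 a, r) else t.
have [||F cF Fg] := @cmp_iter_code (B * seq A) X _ _ N step (fun x => (b x, s x)) cN.
- apply: cmp_uncons; first by apply: cmp_snd; apply: cmp_snd; exact: cmp_id.
    apply: cmp_pair; last by do 2 apply: cmp_snd; exact: cmp_id.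
    apply: (@cmp_comp _ _ _ _ _ _ (fun y : X * (B * A) => g y.1 y.2.1 y.2.2)
      (fun y => (y.1.1, (y.1.2.1, y.2.1)))) => //.
    apply: cmp_pair; first by do 2 apply: cmp_fst; exact: cmp_id.
    apply: cmp_pair; first by apply: cmp_fst; apply: cmp_snd; apply: cmp_fst; exact: cmp_id.
    by apply: cmp_fst; apply: cmp_snd; exact: cmp_id.
  by apply: cmp_snd; exact: cmp_id.
- exact: cmp_pair.
exists (nfst \o F); first exact: ncomp_comp ncomp_fst cF.
move=> n; move: (Fg n) => /= /(congr1 fst) /= ->.
have it k c l : size l <= k -> iter k (step (dec n)) (c, l) = (foldl (g (dec n)) c l, [::]).
  elim: k c l => [|k IH] c [|a l] // sl; first by rewrite iterS IH.
  by rewrite iterSr /= IH.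
rewrite it //= -Ns /= size_map; exact: size_dec_list.
Qed.

End Fold.

Lemma cmp2 A B C X {rA : rep A} {rB : rep B} {rC : rep C} {rX : rep X}
    (f : A -> B -> C) (g : X -> A) (h : X -> B) :
  cmp (fun y : A * B => f y.1 y.2) -> cmp g -> cmp h -> cmp (fun x => f (g x) (h x)).
Proof. by move=> cf cg ch; exact: (cmp_comp cf (cmp_pair cg ch)). Qed.

Lemma cmp_proj1 A B {rA : rep A} {rB : rep B} : cmp (fun x : A * B => x.1).
Proof. by apply: cmp_fst; exact: cmp_id. Qed.

Lemma cmp_proj2 A B {rA : rep A} {rB : rep B} : cmp (fun x : A * B => x.2).
Proof. by apply: cmp_snd; exact: cmp_id. Qed.

(* [cmp_op] is extended below with the closure lemma of each new operation.  It
   comes before the projections, which could match by unfolding definitions. *)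
Ltac cmp_op := fail.
Ltac cmp_eta := lazymatch goal with
  | |- cmp (fun _ => _) => idtac
  | |- @cmp ?A ?B ?rA ?rB ?f => change (@cmp A B rA rB (fun x => f x))
  end.
Ltac cmp_tac := cbn beta iota zeta delta [fst snd]; cmp_eta; first
  [ assumption
  | solve [eapply cmp_id]
  | solve [eapply cmp_const]
  | match goal with H : cmp _ |- _ => eapply (cmp_comp H); cmp_tac end
  | match goal with H : cmp (fun y => _ y.1 y.2) |- _ => eapply (cmp2 H); cmp_tac end
  | cmp_op; cmp_tac
  | lazymatch goal with
    | |- cmp (fun x => Some (@?f x)) => eapply cmp_some
    | |- cmp (fun x => cons (@?f x) (@?g x)) => eapply cmp_cons
    | |- cmp (fun x => pair (@?f x) (@?g x)) => eapply cmp_pair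
    | |- cmp (fun x => fst (@?f x)) => eapply cmp_fst
    | |- cmp (fun x => snd (@?f x)) => eapply cmp_snd
    | |- _ => first [eapply cmp_if | eapply cmp_uncons | eapply cmp_opt]
    end; cmp_tac ].

Lemma cmp_succn X {rX : rep X} (f : X -> nat) : cmp f -> cmp (fun x => (f x).+1).
Proof. by apply: cmp_comp; exists succn => //; exact: ncomp_succ. Qed.

Lemma cmp_predn X {rX : rep X} (f : X -> nat) : cmp f -> cmp (fun x => (f x).-1).
Proof. by apply: cmp_comp; exists predn => //; exact: ncomp_pred. Qed.

Lemma cmp_gt0 X {rX : rep X} (f : X -> nat) : cmp f -> cmp (fun x => 0 < f x).
Proof. by apply: cmp_comp; exists id => //; exact: ncomp_id. Qed.

Lemma cmp_addn X {rX : rep X} (f g : X -> nat) :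
  cmp f -> cmp g -> cmp (fun x => f x + g x).
Proof.
move=> cf cg; apply: (@cmp_ext _ _ _ _ (fun x => iter (f x) succn (g x))).
  by move=> x; elim: (f x) => //= n ->.
eapply cmp_iter; [|eapply cmp_succn|]; cmp_tac.
Qed.

Lemma cmp_subn X {rX : rep X} (f g : X -> nat) :
  cmp f -> cmp g -> cmp (fun x => f x - g x).
Proof.
move=> cf cg; apply: (@cmp_ext _ _ _ _ (fun x => iter (g x) predn (f x))).
  by move=> x; elim: (g x) => [|n /= ->]; [rewrite subn0 | rewrite subnS].
eapply cmp_iter; [|eapply cmp_predn|]; cmp_tac.
Qed.

Lemma cmp_muln X {rX : rep X} (f g : X -> nat) :
  cmp f -> cmp g -> cmp (fun x => f x * g x).
Proof.
move=> cf cg; apply: (@cmp_ext _ _ _ _ (fun x => iter (f x) (addn (g x)) 0)).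
  by move=> x; rewrite iter_addn addn0 mulnC.
eapply cmp_iter; [|eapply cmp_addn|]; cmp_tac.
Qed.

Lemma cmp_expn X {rX : rep X} (f g : X -> nat) :
  cmp f -> cmp g -> cmp (fun x => f x ^ g x).
Proof.
move=> cf cg; apply: (@cmp_ext _ _ _ _ (fun x => iter (g x) (muln (f x)) 1)).
  by move=> x; rewrite iter_muln muln1.
eapply cmp_iter; [|eapply cmp_muln|]; cmp_tac.
Qed.

Lemma cmp_negb X {rX : rep X} (b : X -> bool) : cmp b -> cmp (fun x => ~~ b x).
Proof. by move=> cb; eapply cmp_if; cmp_tac. Qed.

Lemma cmp_andb X {rX : rep X} (b c : X -> bool) :
  cmp b -> cmp c -> cmp (fun x => b x && c x).
Proof. by move=> cb cc; eapply cmp_if; cmp_tac. Qed.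

Lemma cmp_orb X {rX : rep X} (b c : X -> bool) :
  cmp b -> cmp c -> cmp (fun x => b x || c x).
Proof. by move=> cb cc; eapply cmp_if; cmp_tac. Qed.

Lemma cmp_implyb X {rX : rep X} (b c : X -> bool) :
  cmp b -> cmp c -> cmp (fun x => b x ==> c x).
Proof. by move=> cb cc; eapply cmp_if; cmp_tac. Qed.

Lemma cmp_leq X {rX : rep X} (f g : X -> nat) :
  cmp f -> cmp g -> cmp (fun x => f x <= g x).
Proof.
move=> cf cg; apply: (@cmp_ext _ _ _ _ (fun x => ~~ (0 < f x - g x))).
  by move=> x; rewrite subn_gt0 -leqNgt.
by eapply cmp_negb; eapply cmp_gt0; eapply cmp_subn; cmp_tac.
Qed.

(** ** Decidable equality *)

Class ceq (A : eqType) {rA : rep A} : Prop := ceqP : cmp (fun x : A * A => x.1 == x.2).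
Arguments ceq A {rA}.

Lemma cmp_eq (A : eqType) X {rA : rep A} {rX : rep X} {eA : ceq A} (f g : X -> A) :
  cmp f -> cmp g -> cmp (fun x => f x == g x).
Proof. by move=> cf cg; exact: (cmp_comp eA (cmp_pair cf cg)). Qed.

Ltac cmp_arith := lazymatch goal with
  | |- cmp (fun x => leq 1 (@?f x)) => eapply cmp_gt0
  | |- cmp (fun x => andb (@?f x) (@?g x)) => eapply cmp_andb
  | |- cmp (fun x => orb (@?f x) (@?g x)) => eapply cmp_orb
  | |- cmp (fun x => negb (@?f x)) => eapply cmp_negb
  | |- cmp (fun x => implb (@?f x) (@?g x)) => eapply cmp_implyb
  | |- cmp (fun x => leq (@?f x) (@?g x)) => eapply cmp_leq
  | |- cmp (fun x => @eq_op _ (@?f x) (@?g x)) => eapply cmp_eq; [typeclasses eauto | |]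
  | |- cmp (fun x => addn (@?f x) (@?g x)) => eapply cmp_addn
  | |- cmp (fun x => subn (@?f x) (@?g x)) => eapply cmp_subn
  | |- cmp (fun x => muln (@?f x) (@?g x)) => eapply cmp_muln
  | |- cmp (fun x => expn (@?f x) (@?g x)) => eapply cmp_expn
  | |- cmp (fun x => S (@?f x)) => eapply cmp_succn
  | |- cmp (fun x => predn (@?f x)) => eapply cmp_predn
  end.
Ltac cmp_op ::= cmp_arith.

Instance ceq_nat : ceq nat.
Proof.
apply: (@cmp_ext _ _ _ _ (fun x => (x.1 <= x.2) && (x.2 <= x.1))).
  by move=> x; rewrite -eqn_leq.
cmp_tac.
Qed.

Instance ceq_bool : ceq bool.
Proof.
apply: (@cmp_ext _ _ _ _ (fun x => if x.1 then x.2 else ~~ x.2)).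
  by case=> [] [] [].
cmp_tac.
Qed.

Instance ceq_prod (A B : eqType) {rA : rep A} {rB : rep B} {eA : ceq A} {eB : ceq B} :
  ceq (A * B)%type.
Proof.
apply: (@cmp_ext _ _ _ _ (fun x => (x.1.1 == x.2.1) && (x.1.2 == x.2.2))).
  by case=> [] [].
cmp_tac.
Qed.

Instance ceq_seq (A : eqType) {rA : rep A} {eA : ceq A} : ceq (seq A).
Proof.
(* The fold over one list consumes the other; the lists agree when the flag survives and nothing is
   left over. *)
pose g (t : bool * seq A) a := if t.2 is b :: r then (t.1 && (a == b), r) else (false, [::]).
apply: (@cmp_ext _ _ _ _ (fun x => let t := foldl g (true, x.2) x.1 in
    t.1 && (if t.2 is _ :: _ then false else true))).
  have F s r : (foldl g (false, r) s).1 = false.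
    by elim: s r => //= c s IH [|d r] //=; rewrite ?IH.
  have E s t b : (foldl g (b, t) s).1 &&
      (if (foldl g (b, t) s).2 is _ :: _ then false else true) = b && (s == t).
    elim: s t b => [|a s IH] [|b' t] b //=; first by rewrite F andbF.
    by rewrite IH eqseq_cons andbA.
  by move=> x; rewrite /= E.
have cg : cmp (fun y : (bool * seq A) * A => g y.1 y.2).
  by eapply cmp_uncons; cmp_tac.
have cf : cmp (fun x : seq A * seq A => foldl g (true, x.2) x.1).
  by eapply cmp_foldl; cmp_tac.
by eapply cmp_andb; [cmp_tac | eapply cmp_uncons; cmp_tac].
Qed.

(** ** Sequences *)

Lemma cmp_rev A X {rA : rep A} {rX : rep X} (s : X -> seq A) :
  cmp s -> cmp (fun x => rev (s x)).
Proof.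
move=> cs; apply: (@cmp_ext _ _ _ _ (fun x => foldl (fun r a => a :: r) [::] (s x))).
  move=> x; rewrite -[RHS]cats0 -[RHS]catrevE.
  by elim: (s x) [::] => //= a r IH t; rewrite IH.
eapply cmp_foldl; cmp_tac.
Qed.

Lemma cmp_foldr A B X {rA : rep A} {rB : rep B} {rX : rep X}
    (g : X -> A -> B -> B) (b : X -> B) (s : X -> seq A) :
  cmp (fun y : X * (A * B) => g y.1 y.2.1 y.2.2) -> cmp b -> cmp s ->
  cmp (fun x => foldr (g x) (b x) (s x)).
Proof.
move=> cg cb cs.
apply: (@cmp_ext _ _ _ _ (fun x => foldl (fun z a => g x a z) (b x) (rev (s x)))).
  by move=> x; rewrite foldl_rev.
eapply cmp_foldl; [|cmp_tac|exact: cmp_rev].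
by apply: (cmp_comp (g := fun y : X * (B * A) => (y.1, (y.2.2, y.2.1))) cg); cmp_tac.
Qed.

Lemma cmp_map A B X {rA : rep A} {rB : rep B} {rX : rep X}
    (f : X -> A -> B) (s : X -> seq A) :
  cmp (fun y : X * A => f y.1 y.2) -> cmp s -> cmp (fun x => map (f x) (s x)).
Proof.
move=> cf cs; apply: (@cmp_ext _ _ _ _ (fun x => foldr (fun a r => f x a :: r) [::] (s x))).
  by move=> x; elim: (s x) => //= a r ->.
eapply cmp_foldr; cmp_tac.
Qed.

Lemma cmp_cat A X {rA : rep A} {rX : rep X} (s t : X -> seq A) :
  cmp s -> cmp t -> cmp (fun x => s x ++ t x).
Proof.
move=> cs ct; apply: (@cmp_ext _ _ _ _ (fun x => foldr cons (t x) (s x))).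
  by move=> x; elim: (s x) => //= a r ->.
eapply cmp_foldr; cmp_tac.
Qed.

Lemma cmp_flatten A X {rA : rep A} {rX : rep X} (s : X -> seq (seq A)) :
  cmp s -> cmp (fun x => flatten (s x)).
Proof. by move=> cs; eapply cmp_foldr; [eapply cmp_cat| |]; cmp_tac. Qed.

Lemma cmp_size A X {rA : rep A} {rX : rep X} (s : X -> seq A) :
  cmp s -> cmp (fun x => size (s x)).
Proof.
move=> cs; apply: (@cmp_ext _ _ _ _ (fun x => foldr (fun _ => succn) 0 (s x))).
  by move=> x; elim: (s x) => //= a r ->.
eapply cmp_foldr; cmp_tac.
Qed.

Lemma cmp_all A X {rA : rep A} {rX : rep X} (p : X -> A -> bool) (s : X -> seq A) :
  cmp (fun y : X * A => p y.1 y.2) -> cmp s -> cmp (fun x => all (p x) (s x)).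
Proof.
move=> cp cs; apply: (@cmp_ext _ _ _ _ (fun x => foldr (fun a b => p x a && b) true (s x))).
  by move=> x; elim: (s x) => //= a r ->.
eapply cmp_foldr; cmp_tac.
Qed.

Lemma cmp_has A X {rA : rep A} {rX : rep X} (p : X -> A -> bool) (s : X -> seq A) :
  cmp (fun y : X * A => p y.1 y.2) -> cmp s -> cmp (fun x => has (p x) (s x)).
Proof.
move=> cp cs; apply: (@cmp_ext _ _ _ _ (fun x => foldr (fun a b => p x a || b) false (s x))).
  by move=> x; elim: (s x) => //= a r ->.
eapply cmp_foldr; cmp_tac.
Qed.

Lemma cmp_mem (A : eqType) X {rA : rep A} {rX : rep X} {eA : ceq A}
    (f : X -> A) (s : X -> seq A) :
  cmp f -> cmp s -> cmp (fun x => f x \in s x).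
Proof.
move=> cf cs; apply: (@cmp_ext _ _ _ _ (fun x => has (fun a => a == f x) (s x))).
  by move=> x; rewrite -has_pred1.
eapply cmp_has; cmp_tac.
Qed.

Lemma cmp_nseq A X {rA : rep A} {rX : rep X} (n : X -> nat) (f : X -> A) :
  cmp n -> cmp f -> cmp (fun x => nseq (n x) (f x)).
Proof.
move=> cn cf; apply: (@cmp_ext _ _ _ _ (fun x => iter (n x) (cons (f x)) [::])).
  by move=> x; elim: (n x) => //= k ->.
eapply cmp_iter; cmp_tac.
Qed.

Lemma cmp_iota X {rX : rep X} (m n : X -> nat) :
  cmp m -> cmp n -> cmp (fun x => iota (m x) (n x)).
Proof.
move=> cm cn.
apply: (@cmp_ext _ _ _ _ (fun x =>
    iter (n x) (fun l => l ++ [:: m x + size l]) [::])).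
  move=> x; elim: (n x) => // k IH; rewrite iterS IH size_iota.
  by rewrite -[k.+1]addn1 iotaD.
by eapply cmp_iter; [| eapply cmp_cat; [|eapply cmp_cons; [eapply cmp_addn; [|eapply cmp_size]|]] |]; cmp_tac.
Qed.

Lemma cmp_nth A X {rA : rep A} {rX : rep X} (d : X -> A) (s : X -> seq A) (n : X -> nat) :
  cmp d -> cmp s -> cmp n -> cmp (fun x => nth (d x) (s x) (n x)).
Proof.
move=> cd cs cn.
apply: (@cmp_ext _ _ _ _ (fun x =>
    if iter (n x) behead (s x) is a :: r then a else d x)).
  move=> x; elim: (n x) (s x) => [|k IH] [|a r] //; rewrite iterSr IH //=.
  by rewrite !nth_nil.
by eapply cmp_uncons; [eapply cmp_iter; [|eapply cmp_uncons|] | |]; cmp_tac.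
Qed.

Ltac cmp_seq := lazymatch goal with
  | |- cmp (fun x => cat (@?f x) (@?g x)) => eapply cmp_cat
  | |- cmp (fun x => nseq (@?f x) (@?g x)) => eapply cmp_nseq
  | |- cmp (fun x => size (@?f x)) => eapply cmp_size
  | |- cmp (fun x => rev (@?f x)) => eapply cmp_rev
  | |- cmp (fun x => iota (@?f x) (@?g x)) => eapply cmp_iota
  | |- cmp (fun x => in_mem (@?f x) (mem (@?g x))) => eapply cmp_mem; [typeclasses eauto | |]
  | |- cmp (fun x => all (@?p x) (@?g x)) => eapply cmp_all
  | |- cmp (fun x => has (@?p x) (@?g x)) => eapply cmp_has
  | |- cmp (fun x => map (@?p x) (@?g x)) => eapply cmp_map
  | |- cmp (fun x => flatten (@?g x)) => eapply cmp_flatten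
  | |- cmp (fun x => nth (@?d x) (@?g x) (@?n x)) => eapply cmp_nth
  | |- cmp (fun x => foldr (@?p x) (@?f x) (@?g x)) => eapply cmp_foldr
  | |- cmp (fun x => foldl (@?p x) (@?f x) (@?g x)) => eapply cmp_foldl
  | |- cmp (fun x => iter (@?p x) (@?f x) (@?g x)) => eapply cmp_iter
  end.
Ltac cmp_op ::= first [cmp_arith | cmp_seq].

(** * Bounded simulation of Turing machines is computable *)

Lemma enc_finK (T : finType) (x0 : T) :
  cancel (fun x => index x (enum T)) (nth x0 (enum T)).
Proof. by move=> x; rewrite nth_index // mem_enum. Qed.
Definition rep_fin (T : finType) (x0 : T) : rep T := Rep (@enc_finK T x0).

Lemma ncomp_nth d s : ncomp (nth d s).
Proof.
elim: s => [|a s IH].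
  by apply: (@ncomp_ext (fun=> d)) (ncomp_const d) => n; rewrite nth_nil.
apply: (@ncomp_ext (fun n => if n is 0 then a else nth d s n.-1)); first by case.
apply: ncomp_ifz; [exact: ncomp_id | | exact: ncomp_const].
exact: ncomp_comp IH ncomp_pred.
Qed.

(** A finite table. Its default entry matters, because a code beyond [enum T] decodes to [x0]. *)
Lemma cmp_fin (T : finType) (x0 : T) A {rA : rep A} (h : T -> A) :
  cmp (rA := rep_fin x0) h.
Proof.
exists (nth (enc (h x0)) [seq enc (h x) | x <- enum T]); first exact: ncomp_nth.
move=> n /=; have [nT|nT] := ltnP n (size (enum T)).
  by rewrite (nth_map x0) // encK.
have sT : size [seq enc (h x) | x <- enum T] <= n by rewrite size_map.
by rewrite (nth_default _ sT) encK nth_default.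
Qed.

(** Each value of [g] gets its own program. A transition table can thus be used although its
    actions, being functions, are never given codes. *)
Lemma cmp_fin_case (T : finType) A X {rA : rep A} {rX : rep X}
    (g : X -> T) (f : T -> X -> A) :
  (forall t, cmp (fun x => g x == t)) -> (forall t, cmp (f t)) ->
  cmp (fun x => f (g x) x).
Proof.
move=> cg cf.
have cs (s : seq T) : forall f0 : X -> A, cmp f0 -> cmp (fun x =>
    if g x \in s then f (g x) x else f0 x).
  elim: s => [|t s IH] f0 c0 //.
  apply: (@cmp_ext _ _ _ _ (fun x =>
    if g x == t then f t x else if g x \in s then f (g x) x else f0 x)).
    by move=> x; rewrite inE; case: eqP => [<-|].
  by eapply cmp_if => //; exact: IH.
have [x0|T0] := pickP (pred_of_simpl (@predT T)).
  move=> _; apply: cmp_ext (cs (enum T) (f x0) (cf x0)) => x; by rewrite mem_enum.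
have X0 (x : X) : False by have := T0 (g x).
by exfalso; exact: (X0 (dec 0)).
Qed.

Section FiniteFunctions.
Context {A : Type} {rA : rep A} {k : nat}.

Lemma enc_ffunK : cancel (fun f : {ffun 'I_k -> A} => enc [seq f i | i <- enum 'I_k])
  (fun n => [ffun i : 'I_k => nth (dec 0) (dec n) i]).
Proof.
move=> f; apply/ffunP => i; rewrite ffunE encK (nth_map i) ?size_enum_ord //.
by rewrite nth_ord_enum.
Qed.

End FiniteFunctions.
Instance rep_ffun A {rA : rep A} k : rep {ffun 'I_k -> A} := Rep (@enc_ffunK A rA k).

Lemma cmp_ffun A X {rA : rep A} {rX : rep X} k (f : X -> 'I_k -> A) :
  (forall i, cmp (fun x => f x i)) -> cmp (fun x => [ffun i => f x i]).
Proof.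
move=> cf.
have [|F cF Ff] := @cmp_ext _ _ rX _ (fun x => [seq f x i | i <- enum 'I_k]) _ (fun=> erefl).
  by elim: (enum _) => [|i s IH]; [exact: cmp_const | exact: cmp_cons].
exists F => // n; apply/ffunP => i; rewrite !ffunE Ff.
by rewrite (nth_map i) ?size_enum_ord // nth_ord_enum.
Qed.

Lemma cmp_ffun_app A X {rA : rep A} {rX : rep X} k (f : X -> {ffun 'I_k -> A}) i :
  cmp f -> cmp (fun x => f x i).
Proof.
move=> cf; apply: (cmp_comp (f := fun h : {ffun 'I_k -> A} => h i)) cf.
have [F cF Ff] : cmp (fun s : seq A => nth (dec 0) s i) by cmp_tac.
by exists F => // n; rewrite Ff /= ffunE.
Qed.

Section Can.
Context {A B X : Type} {rA : rep A} {rX : rep X} {f : B -> A} {g : A -> B}.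
Context {fK : cancel f g}.

Lemma cmp_to_can (h : X -> A) : cmp h -> cmp (rB := rep_can rA fK) (fun x => g (h x)).
Proof. by move=> [H cH Hh]; exists H => // n; rewrite /= Hh. Qed.

Lemma cmp_of_can (gK : cancel g f) (h : X -> B) :
  cmp (rB := rep_can rA fK) h -> cmp (fun x => f (h x)).
Proof. by move=> [H cH Hh]; exists H => // n; rewrite -Hh /= gK. Qed.

End Can.

Section Simulation.
Variable M : turing_machine.
Notation G := (tm_symbol M).
Notation K := (tm_tapes M).+1.

(** Idling after the halt makes bounded simulation a plain iteration, with results monotone in the
    number of steps. *)
Definition tm_next (c : tm_config M) : tm_config M := odflt c (tm_step c).
Definition tm_after (s : nat) (w : bitstring) : tm_config M := iter s tm_next (tm_init M w).
Definition tm_halted (c : tm_config M) : bool := ~~ tm_step c.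
Definition tm_result (s : nat) (w : bitstring) : option bitstring :=
  if tm_halted (tm_after s w) then Some (tm_output (tm_after s w)) else None.

Lemma tm_runE k c : tm_run k c =
  if tm_halted (iter k tm_next c) then Some (iter k tm_next c) else None.
Proof.
elim: k c => [|k IH] c; first by rewrite /= /tm_halted; case: (tm_step c).
rewrite iterSr {2 4}/tm_next /=; case E: (tm_step c) => [c'|] /=; first exact: IH.
have -> : iter k tm_next c = c by elim: k {IH} => //= k ->; rewrite /tm_next E.
by rewrite /tm_halted E.
Qed.

Lemma tm_resultP w v : computes M w v <-> exists s, tm_result s w = Some v.
Proof.
rewrite /tm_result /tm_after; split=> [[k [c]]|[s]].
  by rewrite tm_runE => -[H <-]; exists k; move: H; case: ifP => // _ [->].
by case: ifP => // H [<-]; exists s, (tm_after s w); rewrite tm_runE H.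
Qed.

Lemma tm_result_mono s t w v : s <= t -> tm_result s w = Some v -> tm_result t w = Some v.
Proof.
move=> /subnKC <-; rewrite /tm_result; case: ifP => // H [<-].
suff -> : tm_after (s + (t - s)) w = tm_after s w by rewrite H.
rewrite addnC /tm_after iterD -/(tm_after s w); elim: (t - s) => //= k ->.
by move: H; rewrite /tm_halted /tm_next; case: (tm_step _).
Qed.

Instance rep_state : rep (tm_state M) := rep_fin (tm_start M).
Instance rep_cell : rep (cell G) := rep_fin None.

Definition untape (t : tape G) := (tape_left t, (tape_head t, tape_right t)).
Definition totape (x : seq (cell G) * (cell G * seq (cell G))) := Tape x.1 x.2.1 x.2.2.
Lemma untapeK : cancel untape totape. Proof. by case. Qed.
Lemma totapeK : cancel totape untape. Proof. by case=> ? []. Qed.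
Instance rep_tape : rep (tape G) := rep_can _ untapeK.
Instance rep_config : rep (tm_config M) := rep_prod rep_state (rep_ffun K).

Section Ops.
Context {X : Type} {rX : rep X}.

Lemma cmp_Tape (l : X -> seq (cell G)) (h : X -> cell G) (r : X -> seq (cell G)) :
  cmp l -> cmp h -> cmp r -> cmp (fun x => Tape (l x) (h x) (r x)).
Proof.
by move=> cl ch cr; apply: (cmp_to_can (h := fun x => (l x, (h x, r x)))); do 2 apply: cmp_pair => //.
Qed.

Lemma cmp_tape_left (t : X -> tape G) : cmp t -> cmp (fun x => tape_left (t x)).
Proof. by move=> /(cmp_of_can totapeK); exact: cmp_fst. Qed.

Lemma cmp_tape_head (t : X -> tape G) : cmp t -> cmp (fun x => tape_head (t x)).
Proof. by move=> /(cmp_of_can totapeK) ct; exact: (cmp_fst (cmp_snd ct)). Qed.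

Lemma cmp_tape_right (t : X -> tape G) : cmp t -> cmp (fun x => tape_right (t x)).
Proof. by move=> /(cmp_of_can totapeK) ct; exact: (cmp_snd (cmp_snd ct)). Qed.

Lemma cmp_head (s : X -> seq (cell G)) : cmp s -> cmp (fun x => head None (s x)).
Proof. by move=> cs; eapply cmp_uncons; cmp_tac. Qed.

Lemma cmp_behead (s : X -> seq (cell G)) : cmp s -> cmp (fun x => behead (s x)).
Proof. by move=> cs; eapply cmp_uncons; cmp_tac. Qed.

Lemma cmp_write_move (t : X -> tape G) a : cmp t -> cmp (fun x => write_move (t x) a).
Proof.
move=> ct; have cl := cmp_tape_left ct; have cr := cmp_tape_right ct.
pose f x := match a.2 with
  | MoveL => Tape (behead (tape_left (t x))) (head None (tape_left (t x))) (a.1 :: tape_right (t x))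
  | Stay => Tape (tape_left (t x)) a.1 (tape_right (t x))
  | MoveR => Tape (a.1 :: tape_left (t x)) (head None (tape_right (t x))) (behead (tape_right (t x)))
  end.
apply: (@cmp_ext _ _ _ _ f); first by move=> x; rewrite /f; case: (t x).
rewrite /f; case: a.2; apply: cmp_Tape; do ?[apply: cmp_head|apply: cmp_behead|apply: cmp_cons|apply: cmp_const|done].
Qed.

End Ops.

Definition heads_of (c : tm_config M) : {ffun 'I_K -> cell G} := [ffun i => tape_head (c.2 i)].

Lemma cmp_heads_eq q h : cmp (fun c : tm_config M => (c.1, heads_of c) == (q, h)).
Proof.
apply: (@cmp_ext _ _ _ _ (fun x : tm_config M =>
    (x.1 == q) && all (fun i => tape_head (x.2 i) == h i) (enum 'I_K))).
  move=> x; rewrite xpair_eqE; congr (_ && _); apply/allP/eqP => [H|<- i _].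
    by apply/ffunP => i; rewrite ffunE; apply/eqP; apply: H; rewrite mem_enum.
  by rewrite ffunE.
apply: cmp_andb; first by apply: (cmp_comp (cmp_fin _ (fun s => s == q))); exact: cmp_proj1.
elim: (enum _) => [|i s IH] /=; first exact: cmp_const.
apply: cmp_andb IH; apply: (cmp_comp (cmp_fin _ (fun s => s == h i))).
by apply: cmp_tape_head; apply: cmp_ffun_app; exact: cmp_proj2.
Qed.

Lemma cmp_tm_case A {rA : rep A} (f : _ -> tm_config M -> A) :
  (forall d, cmp (f d)) -> cmp (fun c => f (tm_delta c.1 (heads_of c)) c).
Proof.
move=> cf; apply: (@cmp_fin_case _ _ _ _ _ (fun c : tm_config M => (c.1, heads_of c))
  (fun t c => f (tm_delta t.1 t.2) c)) => [[q h]|t] //.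
exact: cmp_heads_eq.
Qed.

Lemma cmp_tm_next : cmp tm_next.
Proof.
pose f d (c : tm_config M) : tm_config M := if d is Some (q, act)
  then (q, [ffun i => write_move (c.2 i) (act i)]) else c.
apply: (@cmp_ext _ _ _ _ (fun c => f (tm_delta c.1 (heads_of c)) c)).
  by move=> c; rewrite /f /tm_next /tm_step -/(heads_of c); case: tm_delta => [[]|].
apply: cmp_tm_case => -[[q act]|]; last exact: cmp_id.
apply: cmp_pair; first exact: cmp_const.
by apply: cmp_ffun => i; apply: cmp_write_move; apply: cmp_ffun_app; exact: cmp_proj2.
Qed.

Lemma cmp_tm_halted : cmp tm_halted.
Proof.
apply: (@cmp_ext _ _ _ _ (fun c => (fun d c => ~~ isSome d)
    (tm_delta c.1 (heads_of c)) c)).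
  by move=> c; rewrite /tm_halted /tm_step -/(heads_of c); case: tm_delta => [[]|].
apply: (@cmp_tm_case _ _ (fun d c => ~~ isSome d)) => d; exact: cmp_const.
Qed.

Lemma cmp_tm_output : cmp (@tm_output M).
Proof.
pose bit (c : cell G) := if c is Some (inl b) then Some b else None.
have cb : cmp bit by exact: cmp_fin.
apply: (@cmp_ext _ _ _ _ (fun c : tm_config M =>
  foldr (fun a r => if bit a is Some b then b :: r else [::]) [::]
    (tape_head (c.2 ord0) :: tape_right (c.2 ord0)))).
  move=> c; rewrite /tm_output; elim: (_ :: _) => //= a s ->.
  by rewrite /bit; case: a => [[]|].
have c0 : cmp (fun c : tm_config M => c.2 ord0).
  by apply: cmp_ffun_app; exact: cmp_proj2.
have ch := cmp_tape_head c0; have cr := cmp_tape_right c0.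
by eapply cmp_foldr; [eapply cmp_opt | |]; cmp_tac.
Qed.

Lemma cmp_tm_init : cmp (tm_init M).
Proof.
apply: cmp_pair; first exact: cmp_const.
apply: cmp_ffun => i; case: (i == ord0); last exact: cmp_const.
have cs : cmp (fun w : bitstring => [seq Some (inl b) : cell G | b <- w]).
  apply: cmp_map; last exact: cmp_id.
  apply: (@cmp_ext _ _ _ _ (fun y : bitstring * bool =>
    if y.2 then Some (inl true) else Some (inl false) : cell G)).
    by case=> ? [].
  by apply: cmp_if; [exact: cmp_proj2 | exact: cmp_const | exact: cmp_const].
by apply: cmp_Tape; [exact: cmp_const | exact: cmp_head | exact: cmp_behead].
Qed.

Lemma cmp_tm_result X {rX : rep X} (s : X -> nat) (w : X -> bitstring) :
  cmp s -> cmp w -> cmp (fun x => tm_result (s x) (w x)).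
Proof.
move=> cs cw; have ci := cmp_comp cmp_tm_init cw.
have ca : cmp (fun x => tm_after (s x) (w x)).
  apply: cmp_iter => //; apply: (cmp_comp cmp_tm_next); exact: cmp_proj2.
have co := cmp_comp cmp_tm_output ca; have ch := cmp_comp cmp_tm_halted ca.
by apply: cmp_if => //; [exact: cmp_some | exact: cmp_const].
Qed.

End Simulation.

(** * Turing machines searching for a value of a computable function *)

Lemma dec_npair A B (rA : rep A) (rB : rep B) a b :
  dec (npair a b) = (dec a, dec b) :> A * B.
Proof. by rewrite -[LHS]/(dec (nfst _), dec (nsnd _)) npairK1 npairK2. Qed.

Definition bits (w : bitstring) : seq (cell unit) := [seq Some (inl b) | b <- w].

Definition read_loop (P0 P1 : prog) : prog :=
  While HeadIsBit (If HeadIsOne (Seq (Put None MoveR) P1) (Seq (Put None MoveR) P0)).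

Definition write_loop : prog :=
  While (RegPos 0)
    (Seq (Dec 0) (Seq (unpair_regs 0)
      (Seq (If (RegPos 0) (Put (Some (inl true)) MoveL) (Put (Some (inl false)) MoveL))
        (Seq (clear_reg 0) (move_reg 1 0))))).

Definition one_reg (t : tape unit) (n : nat) : store := upd (Store t (fun=> 0)) 0 n.

Lemma scratch_one_reg t n : scratch_free 0 (one_reg t n).
Proof. by case. Qed.

Lemma ncomp_exec0 f : ncomp f -> exists P, forall t n,
  exec P (one_reg t n) (one_reg t (f n)).
Proof.
move=> /(_ 0)[P Pf]; exists P => t n.
by apply: exec_eq (Pf _ (@scratch_one_reg t n)) _; rewrite /one_reg upd_upd.
Qed.

(** Pushing the bits onto a list code reverses the input. The head ends past the input with only
    blanks to its right, so an output written leftwards from there is properly terminated. *)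
Lemma exec_read_loop : exists P, forall w, exists t n,
  [/\ exec P (init_store w) (one_reg (Tape t None [::]) n) & dec n = rev w].
Proof.
have push b : ncomp (fun n => (npair (nat_of_bool b) n).+1).
  apply: (ncomp_comp ncomp_succ); apply: ncomp_pair; [exact: ncomp_const | exact: ncomp_id].
have [P0 P0E] := ncomp_exec0 (push false); have [P1 P1E] := ncomp_exec0 (push true).
exists (read_loop P0 P1) => w.
have loop l n : exists t m,
    [/\ exec (read_loop P0 P1)
          (one_reg (Tape l (head None (bits w)) (behead (bits w))) n)
          (one_reg (Tape t None [::]) m) & dec m = catrev w (dec n)].
  elim: w l n => [|b w IH] l n.
    by exists l, n; split => //; exact: ExecWhileStop.
  have [t [m [ex E]]] := IH (None :: l) (npair (nat_of_bool b) n).+1.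
  exists t, m; split; last first.
    by rewrite E dec_cons npairK1 npairK2; case: (b).
  apply: ExecWhileStep ex; first by [].
  apply: ExecIf; case: b {E} => /=.
    by apply: ExecSeq (ExecPut _ _ _) _; exact: P1E.
  by apply: ExecSeq (ExecPut _ _ _) _; exact: P0E.
have [t [m [ex E]]] := loop [::] 0; exists t, m; split; last by rewrite E.
by apply: (eq_ind _ (fun s => exec _ s _) ex); store_eq.
Qed.

(** Popping the list while moving left puts its last element leftmost, hence the reversal. *)
Lemma exec_write_loop l h r n : exists l' h',
  exec write_loop (one_reg (Tape l h r) n)
    (one_reg (Tape l' h' (bits (rev (dec n)) ++ r)) 0).
Proof.
have [j] := ubnP n; elim: j n l h r => // j IH [|n] l h r nj.
  by exists l, h; exact: ExecWhileStop.
have [|l' [h' ex]] := IH (nsnd n) (behead l) (head None l) (Some (inl (0 < nfst n)) :: r).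
  by have := nsnd_le n; lia.
exists l', h'; apply: ExecWhileStep; first by [].
  apply: ExecSeq (ExecDec _ _) _; rewrite /= /one_reg upd_upd.
  apply: ExecSeq (exec_unpair_regs _) _; first exact: scratch_one_reg.
  apply: (@ExecSeq _ _ _ (upd (upd (one_reg (Tape (behead l) (head None l)
      (Some (inl (0 < nfst n)) :: r)) n) 0 (nfst n)) 1 (nsnd n))).
    apply: ExecIf; rewrite /=.
    case: (posnP (nfst n)) => _ /=; apply: exec_eq (ExecPut _ _ _) _; exact: storeP.
  apply: ExecSeq (exec_clear _ _) _; exact: exec_move.
apply: exec_eq; last first.
  rewrite dec_cons rev_cons -cats1 /bits map_cat -catA; reflexivity.
apply: (eq_ind _ (fun s => exec _ s _) ex); store_eq.
Qed.

Lemma leading_bitsK w : leading_bits (bits w) = w.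
Proof. by elim: w => //= b w ->. Qed.

(** The machine tries the stages in order and outputs the first value found. The clause that halting
    implies some successful stage is what later gives prefix-freeness. *)
Lemma search_machine (f : nat -> bitstring -> option bitstring) :
  cmp (fun x : nat * bitstring => f x.1 x.2) ->
  exists M : turing_machine,
    (forall p, halting_set M p -> exists s, f s p <> None) /\
    (forall p s w, f s p = Some w -> (forall s', s' < s -> f s' p = None) ->
       computes M p w).
Proof.
(* Reading and writing both reverse, so the register program works with reversed strings. *)
move=> cf; pose g (x : nat * bitstring) := if f x.1 (rev x.2) is Some w
  then Some (rev w) else None.
have [F cF Fg] : cmp g by eapply cmp_opt; cmp_tac.
(* The second component is a flag that [unpair_regs 0] drops into register 1, the register tested by
   the loop: 1 moves on to the next stage, 0 stops with the output in register 0. *)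
pose body n := if F n is 0 then npair (npair (nfst n).+1 (nsnd n)) 1
  else npair (F n).-1 0.
have cbody : ncomp body.
  apply: ncomp_ifz => //.
    apply: ncomp_pair; [exact: ncomp_comp ncomp_pred cF | exact: ncomp_const].
  apply: ncomp_pair; last exact: ncomp_const.
  apply: ncomp_pair; last exact: ncomp_snd.
  by apply: (ncomp_comp ncomp_succ); exact: ncomp_fst.
have cinit : ncomp (fun n => npair 0 n).
  by apply: ncomp_pair; [exact: ncomp_const | exact: ncomp_id].
have [PB PBE] := ncomp_exec0 cbody; have [PI PIE] := ncomp_exec0 cinit.
have [PR PRE] := exec_read_loop.
pose pre := Seq PR (Seq PI (Inc 1)).
pose loop := Seq (Dec 1) (Seq PB (unpair_regs 0)).
pose post := Seq write_loop (Put None MoveR).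
exists (prog_machine (Seq pre (Seq (While (RegPos 1) loop) post))).
pose L t pc s := upd (one_reg t (npair s pc)) 1 1.
have loopE t pc s : exec loop (L t pc s)
    (if F (npair s pc) is 0 then L t pc s.+1 else one_reg t (F (npair s pc)).-1).
  apply: ExecSeq (ExecDec _ _) _; apply: (@ExecSeq _ _ _ (one_reg t (body (npair s pc)))).
    apply: (eq_ind _ (fun s => exec _ s _) (PBE t _)); store_eq.
  apply: exec_eq (exec_unpair_regs _) _; first exact: scratch_one_reg.
  rewrite /body /= !npairK1 !npairK2; case: (F _) => [|k]; rewrite !npairK1 !npairK2; store_eq.
have FE pc s p : dec pc = rev p ->
    (if F (npair s pc) is m.+1 then Some (dec m) else None : option bitstring) =
    if f s p is Some w then Some (rev w) else None.
  move=> pcE; have := Fg (npair s pc); rewrite dec_npair /g pcE.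
  by rewrite -[(_, _).2]/(rev p) revK; exact.
have Fnone s pc p : dec pc = rev p -> f s p = None -> F (npair s pc) = 0.
  by move=> /(FE pc s) + fN; rewrite fN; case: (F _).
have preE w : exists t pc, exec pre (init_store w) (L (Tape t None [::]) pc 0) /\
    dec pc = rev w.
  have [t [pc [ex E]]] := PRE w; exists t, pc; split => //.
  by apply: ExecSeq ex _; apply: ExecSeq (PIE _ _) _; apply: exec_eq (ExecInc _ _) _; store_eq.
split=> [p haltp|p s w fs fmin].
  have [//|noS] := pselect (exists s, f s p <> None).
  have fN s : f s p = None by case E : (f s p) => //; case: noS; exists s; rewrite E.
  have [t [pc [ex pcE]]] := preE p.
  case: (prog_machine_diverges (I := fun st => exists s, st = L (Tape t None [::]) pc s)
    ex _ _ haltp); first by exists 0.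
  move=> _ [s ->]; split => //; exists (L (Tape t None [::]) pc s.+1); last by exists s.+1.
  by have := loopE (Tape t None [::]) pc s; rewrite (Fnone _ _ _ pcE (fN s)).
have [t [pc [ex pcE]]] := preE p.
have runE j : j <= s -> exec (While (RegPos 1) loop) (L (Tape t None [::]) pc (s - j))
    (one_reg (Tape t None [::]) (F (npair s pc)).-1).
  elim: j => [|j IH] js.
    rewrite subn0; apply: ExecWhileStep (loopE _ _ _) _ => //.
    have := FE _ s _ pcE; rewrite fs.
    by case: (F _) => // k _; exact: ExecWhileStop.
  apply: ExecWhileStep (loopE _ _ _) _ => //.
  rewrite (Fnone _ _ _ pcE (fmin _ _)); last by lia.
  by rewrite subnSK //; apply: IH; exact: ltnW.
have := runE s (leqnn _); rewrite subnn => {}runE.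
have [l' [h' wr]] := exec_write_loop t None [::] (F (npair s pc)).-1.
have E : dec (F (npair s pc)).-1 = rev w.
  by have := FE _ s _ pcE; rewrite fs; case: (F _) => // k [].
rewrite E revK cats0 in wr.
have -> : w = leading_bits (head None (bits w) :: behead (bits w)).
  by rewrite -[LHS]leading_bitsK; case: (w).
apply: (prog_machine_halts (s := Store (write_move (Tape l' h' (bits w)) (None, MoveR)) _)).
apply: ExecSeq ex _; apply: ExecSeq runE _; apply: ExecSeq wr _.
exact: ExecPut.
Qed.

Import Order.TTheory GRing.Theory Num.Theory.
Import numFieldNormedType.Exports.

(** * Prefix machines from Kraft requests *)

(* Big-endian: [p] denotes the dyadic interval
   [bval p / 2^|p|, (bval p + 1) / 2^|p|). *)
Definition bval (p : bitstring) : nat := foldl (fun a (b : bool) => 2 * a + b) 0 p.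

Lemma bval_cat p q : bval (p ++ q) = bval p * 2 ^ size q + bval q.
Proof.
have from a : foldl (fun a (b : bool) => 2 * a + b) a q = a * 2 ^ size q + bval q.
  rewrite /bval; elim/last_ind: q => [|q b IH]; first by rewrite /= muln1 addn0.
  by rewrite -cats1 !foldl_cat /= IH size_cat /= addn1 expnS; lia.
by rewrite {1}/bval foldl_cat from.
Qed.

Lemma bval1 b : bval [:: b] = b. Proof. by case: b. Qed.

Lemma bval_lt p : bval p < 2 ^ size p.
Proof.
elim/last_ind: p => // p b IH; rewrite -cats1 bval_cat size_cat /= expn1 addn1 expnS.
by rewrite bval1; case: b => /=; lia.
Qed.

Lemma bval_surj L a : a < 2 ^ L -> exists2 p, size p = L & bval p = a.
Proof.
elim: L a => [|L IH] a; first by exists [::] => //; rewrite /bval /=; lia.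
rewrite expnS => aL; have [|p pL pa] := IH a./2; first by lia.
exists (rcons p (odd a)); first by rewrite size_rcons pL.
by rewrite -cats1 bval_cat pa bval1 /= expn1; lia.
Qed.

Lemma cmp_bval X {rX : rep X} (p : X -> bitstring) : cmp p -> cmp (fun x => bval (p x)).
Proof.
move=> cp; apply: (@cmp_ext _ _ _ _ (fun x =>
    foldl (fun a (b : bool) => 2 * a + if b then 1 else 0) 0 (p x))).
  by move=> x; rewrite /bval; congr foldl; apply/funext => a; apply/funext => -[].
cmp_tac.
Qed.

Section KraftChaitin.
Variables (F : realFieldType) (Key : eqType) (rK : rep Key) (eK : ceq Key).
Variables (len : Key -> nat) (cand : nat -> option (Key * bitstring)).
Hypotheses (clen : cmp len) (ccand : cmp cand).

Local Open Scope ring_scope.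

Definition kraft_sum (ks : seq Key) : F := \sum_(k <- ks) 2 ^- len k.

Definition requested (k : Key) : Prop := exists i w, cand i = Some (k, w).

Hypothesis kraft : forall ks, uniq ks -> (forall k, k \in ks -> requested k) ->
  kraft_sum ks <= 1.

(** A key is served only at its first occurrence, since [kraft] bounds lists of distinct keys. *)
Definition see (ks : seq Key) (o : option (Key * bitstring)) : seq Key :=
  if o is Some y then if y.1 \in ks then ks else y.1 :: ks else ks.

Fixpoint seen (s : nat) : seq Key :=
  if s is t.+1 then see (seen t) (cand t) else [::].

(* The Kraft sum as a fraction [num / 2^exponent]. *)
Definition kraft_frac (ks : seq Key) : nat * nat :=
  foldr (fun k d => (d.1 * 2 ^ len k + 2 ^ d.2, d.2 + len k))%N (0, 0)%N ks.

(* The request seen at stage [s] owns the interval of length [2^-len k] starting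
   at the Kraft sum of the earlier requests; its codewords are the dyadic
   intervals of half that length inside it. *)
Definition accept (s : nat) (p : bitstring) : option bitstring :=
  if cand s is Some y then
    let d := kraft_frac (seen s) in
    if [&& y.1 \notin seen s, size p == (len y.1).+1,
          d.1 * 2 ^ size p <= bval p * 2 ^ d.2 &
          (bval p).+1 * 2 ^ d.2 <= d.1 * 2 ^ size p + 2 * 2 ^ d.2]%N
    then Some y.2 else None
  else None.

Lemma cmp_accept : cmp (fun x : nat * bitstring => accept x.1 x.2).
Proof.
have csee : cmp (fun x : seq Key * option (Key * bitstring) => see x.1 x.2).
  by eapply cmp_opt; cmp_tac.
have cseen : cmp seen.
  apply: (@cmp_ext _ _ _ _ (fun s =>
    (iter s (fun t : nat * seq Key => (t.1.+1, see t.2 (cand t.1))) (0%N, [::])).2)).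
    move=> s; suff -> : iter s (fun t : nat * seq Key => (t.1.+1, see t.2 (cand t.1)))
      (0%N, [::]) = (s, seen s) by [].
    by elim: s => //= s ->.
  cmp_tac.
have cfrac : cmp kraft_frac by rewrite /kraft_frac; cmp_tac.
have cval : cmp bval by apply: cmp_bval; exact: cmp_id.
rewrite /accept /=; cmp_tac.
Qed.

Definition lo (p : bitstring) : F := (bval p)%:R / 2 ^+ size p.
Definition hi (p : bitstring) : F := (bval p).+1%:R / 2 ^+ size p.

Lemma pow2_gt0 n : 0 < 2 ^+ n :> F. Proof. by rewrite exprn_gt0. Qed.
Hint Resolve pow2_gt0 : core.

Lemma lo_lt_hi p : lo p < hi p.
Proof. by rewrite ltr_pM2r ?invr_gt0 // ltr_nat. Qed.

Lemma prefix_lo_hi p q : prefix p q -> lo p <= lo q /\ hi q <= hi p.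
Proof.
case/prefixP => r ->; rewrite /lo /hi size_cat exprD bval_cat.
have rr := bval_lt r; split.
  rewrite ler_pdivrMr // mulrAC ler_pdivlMr //.
  by rewrite -!natrX -!natrM ler_nat; nia.
rewrite ler_pdivrMr // mulrAC ler_pdivlMr //.
by rewrite -!natrX -!natrM ler_nat; nia.
Qed.

Lemma kraft_fracE ks :
  kraft_sum ks = (kraft_frac ks).1%:R / 2 ^+ (kraft_frac ks).2.
Proof.
rewrite /kraft_sum; elim: ks => [|k ks IH]; first by rewrite big_nil mul0r.
rewrite big_cons IH /= natrD natrM !natrX exprD invfM mulrDl.
rewrite [X in _ = X + _]mulrACA divff ?expf_neq0 ?pnatr_eq0 // mulr1.
by rewrite mulrA divff ?expf_neq0 ?pnatr_eq0 // mul1r addrC.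
Qed.

Lemma kraft_sum_seenS s : kraft_sum (seen s) <= kraft_sum (seen s.+1).
Proof.
rewrite /= /see; case: (cand s) => // y; case: ifP => // _.
by rewrite {2}/kraft_sum big_cons lerDr invr_ge0 ltW.
Qed.

Lemma kraft_sum_seen s t : (s <= t)%N -> kraft_sum (seen s) <= kraft_sum (seen t).
Proof.
move=> /subnK <-; elim: (t - s)%N => // d IH; apply: (le_trans IH).
exact: kraft_sum_seenS.
Qed.

Lemma acceptP s p w : accept s p = Some w <-> exists k,
  [/\ cand s = Some (k, w), k \notin seen s, size p = (len k).+1,
      kraft_sum (seen s) <= lo p & hi p <= kraft_sum (seen s) + 2 ^- len k].
Proof.
have frac d e (a b : nat) : (a%:R / 2 ^+ e <= b%:R / 2 ^+ d :> F) =
    (a * 2 ^ d <= b * 2 ^ e)%N.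
  by rewrite ler_pdivrMr // mulrAC ler_pdivlMr // -!natrX -!natrM ler_nat.
have sumE k d e a : e = (len k).+1 ->
    a%:R / 2 ^+ d + 2 ^- len k = (a * 2 ^ e + 2 * 2 ^ d)%:R / 2 ^+ (d + e) :> F.
  move=> ->; rewrite natrD !natrM !natrX exprD exprS; field.
  by rewrite !expf_neq0 // pnatr_eq0.
have test k d : size p = (len k).+1 -> ((bval p).+1 * 2 ^ d.2 <=
    d.1 * 2 ^ size p + 2 * 2 ^ d.2)%N = (hi p <= d.1%:R / 2 ^+ d.2 + 2 ^- len k).
  move=> pk; rewrite (sumE k d.2 (size p)) // frac expnD mulnA leq_pmul2r //.
  by rewrite expn_gt0.
rewrite /accept; split.
  case E: (cand s) => [[k v]|] //=.
  case: ifP => // /and4P[kns /eqP pk h1 h2] [<-]; exists k; split => //.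
    by rewrite kraft_fracE frac.
  by rewrite kraft_fracE -test.
case=> k [-> kns pk h1 h2] /=; rewrite kns pk eqxx /= -pk.
by rewrite -frac -kraft_fracE h1 (test k) // -kraft_fracE h2.
Qed.

Lemma kraft_sum_accepted s p w : accept s p = Some w -> hi p <= kraft_sum (seen s.+1).
Proof.
move=> /acceptP[k [E kns _ _ h]]; apply: (le_trans h).
by rewrite /= E /= (negbTE kns) /kraft_sum big_cons addrC.
Qed.

(** The interval of a string contains those of its extensions, whereas different stages own disjoint
    intervals; within one stage all codewords have the same length. *)
Lemma accept_prefix s t p q v w : accept s p = Some v -> accept t q = Some w ->
  prefix p q -> s = t /\ p = q.
Proof.
move=> As At pq; have [lopq hiqp] := prefix_lo_hi pq.
have /acceptP[k [Es _ sp los _]] := As; have /acceptP[l [Et _ sq lot _]] := At.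
have st : s = t.
  apply/eqP; case: ltngtP => // lt; exfalso.
    have := kraft_sum_accepted As; rewrite leNgt => /negP; apply.
    apply: (le_lt_trans (kraft_sum_seen lt)); apply: (le_lt_trans lot).
    exact: (lt_le_trans (lo_lt_hi q)).
  have := kraft_sum_accepted At; rewrite leNgt => /negP; apply.
  apply: (le_lt_trans (kraft_sum_seen lt)); apply: (le_lt_trans los).
  by apply: le_lt_trans lopq _; exact: lo_lt_hi.
split=> //; move: Et; rewrite -st Es => -[kl _].
case/prefixP: pq sq => r ->; rewrite size_cat sp kl => /eqP.
by rewrite -[X in _ == X]addn0 eqn_add2l size_eq0 => /eqP ->; rewrite cats0.
Qed.

Lemma seen_requested s k : k \in seen s -> exists i w, (i < s)%N /\ cand i = Some (k, w).
Proof.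
elim: s => //= s IH; rewrite /see; case E: (cand s) => [[l w]|] /=; last first.
  by move/IH => [i [v [lt ?]]]; exists i, v; split => //; exact: ltnW.
case: ifP => _; last rewrite inE => /predU1P[->|]; last 2 first.
- by exists s, w.
- by move/IH => [i [v [lt ?]]]; exists i, v; split => //; exact: ltnW.
- by move/IH => [i [v [lt ?]]]; exists i, v; split => //; exact: ltnW.
Qed.

Lemma seen_uniq s : uniq (seen s).
Proof.
elim: s => //= s IH; rewrite /see; case: (cand s) => // y.
by case: ifP => //= ->.
Qed.

Lemma accept_exists i k v : cand i = Some (k, v) -> exists s p w,
  [/\ cand s = Some (k, w), accept s p = Some w & size p = (len k).+1].
Proof.
move=> Ei; have ex : exists j, isSome (cand j) && (omap fst (cand j) == Some k).
  by exists i; rewrite Ei /=.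
have [s /andP[]] := ex_minnP ex.
case Es: (cand s) => [[l w]|] //= _ /eqP[lk] smin; move: Es; rewrite {}lk => Es.
have kns : k \notin seen s.
  apply/negP => /seen_requested[j [u [js Ej]]].
  by have := smin j; rewrite Ej /= eqxx leqNgt js => /(_ isT).
have sum1 : kraft_sum (seen s) + 2 ^- len k <= 1.
  have := kraft (seen_uniq s.+1); rewrite /= Es /= (negbTE kns) /kraft_sum big_cons addrC.
  apply => x; rewrite inE => /predU1P[->|/seen_requested[j [u [_ Ej]]]].
    by exists s, w.
  by exists j, u.
move: sum1; rewrite kraft_fracE; set d := kraft_frac _ => sum1.
(* [a / 2^L] is the Kraft sum rounded up to a multiple of [2^-L]. Rounding costs less than [2^-L],
   and the owned interval has length [2 * 2^-L]; this is the reason for the extra bit. *)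
set L := (len k).+1; pose a := ((d.1 * 2 ^ L + (2 ^ d.2 - 1)) %/ 2 ^ d.2)%N.
have e0 : (0 < 2 ^ d.2)%N by rewrite expn_gt0.
have [a1 a2] : (d.1 * 2 ^ L <= a * 2 ^ d.2 /\
    a.+1 * 2 ^ d.2 <= d.1 * 2 ^ L + 2 * 2 ^ d.2)%N.
  rewrite /a; move: (d.1 * 2 ^ L)%N (2 ^ d.2)%N e0 => x e e0.
  have := divn_eq (x + (e - 1)) e; have := ltn_pmod (x + (e - 1)) e0.
  by move: (_ %/ _)%N (_ %% _)%N => y z; nia.
have sum2 : (d.1 * 2 ^ L + 2 * 2 ^ d.2 <= 2 ^ L * 2 ^ d.2)%N.
  rewrite -(ler_nat F) natrD !natrM !natrX.
  have -> : d.1%:R * 2 ^+ L + 2 * 2 ^+ d.2 =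
      (d.1%:R / 2 ^+ d.2 + 2 ^- len k) * (2 ^+ L * 2 ^+ d.2) :> F.
    by rewrite /L exprS; field; rewrite !expf_neq0 // pnatr_eq0.
  by rewrite -[leRHS]mul1r ler_wpM2r // mulr_ge0 // ltW.
have aL : (a < 2 ^ L)%N by rewrite -(leq_pmul2r e0); exact: leq_trans a2 sum2.
have [p pL pa] := bval_surj aL; exists s, p, w; split => //.
by rewrite /accept Es /= -/d kns pL pa eqxx a1 a2.
Qed.

Lemma kraft_chaitin : exists M : turing_machine, prefix_machine M /\
  forall i k v, cand i = Some (k, v) -> exists j p w,
    [/\ cand j = Some (k, w), computes M p w & size p = (len k).+1].
Proof.
have [M [haltM compM]] := search_machine cmp_accept; exists M; split.
  move=> p q /haltM[s Hs] /haltM[t Ht] pq.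
  case Es: (accept s p) Hs => [v|] // _; case Et: (accept t q) Ht => [w|] // _.
  exact: (accept_prefix Es Et pq).2.
move=> i k v /accept_exists[s [p [w [E A pL]]]]; exists s, p, w; split => //.
apply: (compM _ _ _ A) => t ts; case At: (accept t p) => [u|] //.
have [] := accept_prefix At A (prefix_refl p).
by move=> st; rewrite st ltnn in ts.
Qed.

End KraftChaitin.

(** * The standard encodings are injective and computable *)

Lemma delimited_cat_inj u v u' v' :
  delimited u ++ v = delimited u' ++ v' -> u = u' /\ v = v'.
Proof.
rewrite /delimited -!catA /= => E.
have len a b x y : nseq a true ++ false :: x = nseq b true ++ false :: y -> a = b /\ x = y.
  by elim: a b => [|a IH] [|b] //= [] => [->|/IH[-> ->]].
have [s E'] := len _ _ _ _ E.
by move/eqP: E'; rewrite eqseq_cat // => /andP[/eqP -> /eqP ->].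
Qed.

Lemma pair_code_inj u v u' v' : pair_code u v = pair_code u' v' -> u = u' /\ v = v'.
Proof. exact: delimited_cat_inj. Qed.

Lemma seq_code_inj : injective seq_code.
Proof.
elim=> [|u s IH] [|v t] //.
- by rewrite /seq_code /= /delimited; case: (size v).
- by rewrite /seq_code /= /delimited; case: (size u).
- by move=> /delimited_cat_inj[-> /IH ->].
Qed.

Lemma bin_of_nat_inj : injective bin_of_nat.
Proof. exact: can_inj bin_of_natK. Qed.

Lemma nat_code_inj : injective nat_code.
Proof.
move=> m n; rewrite /nat_code => E; apply: bin_of_nat_inj.
have pinj p q : positive_code p = positive_code q -> p = q.
  elim: p q => [p IH|p IH|] [q|q|] //= [].
  - by move/IH ->.
  - by case: p {IH}.
  - by move/IH ->.
  - by case: q.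
case: (bin_of_nat m) (bin_of_nat n) E => [|p] [|q] //.
- by case: q.
- by case: p.
- by move/pinj ->.
Qed.

Lemma int_code_inj : injective int_code.
Proof.
move=> x y [] sxy /nat_code_inj axy.
case: x y sxy axy => [m|m] [n|n] //=; first by move=> _ ->.
by move=> _ [->].
Qed.

Lemma rat_code_inj : injective rat_code.
Proof.
move=> x y /pair_code_inj[/int_code_inj n /int_code_inj d].
by rewrite -(divq_num_den x) -(divq_num_den y) n d.
Qed.

Lemma vec_code_inj n : injective (@vec_code n).
Proof.
move=> u v /seq_code_inj/eq_in_map E; apply/rowP => i.
by apply: rat_code_inj; apply: E; rewrite mem_enum.
Qed.

(** * Computability of numerals, integers, rationals and vectors *)

Fixpoint bits_succ (s : bitstring) : bitstring :=
  match s with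
  | [::] => [:: true]
  | false :: s => true :: s
  | true :: s => false :: bits_succ s
  end.

(** Trades the recursion on [positive] for repeated binary increment, which closure under iteration
    covers. *)
Lemma nat_codeE m : nat_code m = iter m bits_succ [::].
Proof.
have succ p : positive_code (PosDef.Pos.succ p) = bits_succ (positive_code p).
  by elim: p => //= p ->.
elim: m => // m IH; rewrite iterS -IH /nat_code.
have -> : bin_of_nat m.+1 =
    Npos (if bin_of_nat m is Npos p then PosDef.Pos.succ p else xH).
  apply: (can_inj nat_of_binK); rewrite bin_of_natK.
  move: (bin_of_natK m); case: (bin_of_nat m) => [|p] /= <- //.
  by rewrite nat_of_succ_pos.
by case: (bin_of_nat m) => //= p; rewrite succ.
Qed.

Lemma cmp_nat_code X {rX : rep X} (m : X -> nat) : cmp m -> cmp (fun x => nat_code (m x)).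
Proof.
(* The increment reuses the unchanged tail, which a fold does not see; the fold therefore returns
   the string together with its successor. *)
move=> cm; pose g (b : bool) (t : bitstring * bitstring) :=
  (b :: t.1, if b then false :: t.2 else true :: t.1).
have cs : cmp bits_succ.
  apply: (@cmp_ext _ _ _ _ (fun s => (foldr g ([::], [:: true]) s).2)).
    move=> s; suff -> : foldr g ([::], [:: true]) s = (s, bits_succ s) by [].
    by elim: s => //= b s ->; rewrite /g /=; case: b.
  rewrite /g; cmp_tac.
apply: (@cmp_ext _ _ _ _ (fun x => iter (m x) bits_succ [::])).
  by move=> x; rewrite nat_codeE.
cmp_tac.
Qed.

Lemma cmp_delimited X {rX : rep X} (w : X -> bitstring) : cmp w -> cmp (fun x => delimited (w x)).
Proof. by move=> cw; rewrite /delimited; cmp_tac. Qed.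

Lemma cmp_pair_code X {rX : rep X} (u v : X -> bitstring) :
  cmp u -> cmp v -> cmp (fun x => pair_code (u x) (v x)).
Proof. by move=> cu cv; apply: cmp_cat => //; exact: cmp_delimited. Qed.

Lemma cmp_seq_code X {rX : rep X} (s : X -> seq bitstring) : cmp s -> cmp (fun x => seq_code (s x)).
Proof.
move=> cs; have cd := cmp_delimited (@cmp_id bitstring _).
rewrite /seq_code; cmp_tac.
Qed.

Definition int_split (z : int) : bool * nat :=
  match z with Posz n => (false, n) | Negz n => (true, n) end.
Definition int_join (x : bool * nat) : int := if x.1 then Negz x.2 else Posz x.2.
Lemma int_splitK : cancel int_split int_join. Proof. by case. Qed.
Lemma int_joinK : cancel int_join int_split. Proof. by case=> [] []. Qed.
Instance rep_int : rep int := rep_can _ int_splitK.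

Instance ceq_int : ceq int.
Proof.
have c : cmp int_split := cmp_of_can int_joinK (@cmp_id int rep_int).
apply: (@cmp_ext _ _ _ _ (fun x => int_split x.1 == int_split x.2)); last by cmp_tac.
by move=> x; rewrite (inj_eq (can_inj int_splitK)).
Qed.

Definition pos_part (z : int) : nat := if z is Posz n then n else 0.
Definition neg_part (z : int) : nat := if z is Negz n then n.+1 else 0.

Lemma cmp_rep_can A B C {rA : rep A} {rC : rep C} (f : B -> A) (g : A -> B)
    (fK : cancel f g) (k : B -> C) (h : A -> C) :
  cmp h -> (forall a, k (g a) = h a) -> cmp (rA := rep_can rA fK) k.
Proof. by move=> [H cH Hh] kg; exists H => // n; rewrite Hh -kg. Qed.

Lemma cmp_pos_part : cmp pos_part.
Proof.
apply: (@cmp_rep_can _ _ _ _ _ _ _ _ _ (fun x : bool * nat => if x.1 then 0 else x.2)).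
  by cmp_tac.
by case=> [] [].
Qed.

Lemma cmp_neg_part : cmp neg_part.
Proof.
apply: (@cmp_rep_can _ _ _ _ _ _ _ _ _ (fun x : bool * nat => if x.1 then x.2.+1 else 0)).
  by cmp_tac.
by case=> [] [].
Qed.

Lemma cmp_int_code X {rX : rep X} (z : X -> int) : cmp z -> cmp (fun x => int_code (z x)).
Proof.
move=> cz; have cp := cmp_comp cmp_pos_part cz; have cn := cmp_comp cmp_neg_part cz.
apply: (@cmp_ext _ _ _ _ (fun x => (0 < neg_part (z x)) ::
    nat_code (pos_part (z x) + neg_part (z x)))).
  by move=> x; case: (z x) => m; rewrite /int_code /= ?addn0 // add0n.
by apply: cmp_cons; [exact: cmp_gt0 | apply: cmp_nat_code; exact: cmp_addn].
Qed.

Lemma cmp_posz X {rX : rep X} (m : X -> nat) : cmp m -> cmp (fun x => Posz (m x)).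
Proof.
by move=> cm; apply: (cmp_to_can (h := fun x => (false, m x))); cmp_tac.
Qed.

Lemma cmp_coprime : cmp (fun x : nat * nat => coprime x.1 x.2.+1).
Proof.
have cd : cmp (fun x : nat * nat => x.1 %| x.2).
  apply: (@cmp_ext _ _ _ _ (fun x => has (fun e => e * x.1 == x.2) (iota 0 x.2.+1))).
    move=> [d m]; apply/hasP/dvdnP => [[e _ /eqP]|[e ->]]; first by exists e.
    case: (posnP d) => [->|d0]; first by exists 0 => //; rewrite /= !muln0.
    by exists e; rewrite ?mem_iota /=; nia.
  cmp_tac.
apply: (@cmp_ext _ _ _ _ (fun x => all (fun d => (d %| x.1) && (d %| x.2.+1) ==> (d == 1))
    (iota 0 x.2.+2))); last by cmp_tac.
move=> [a b]; apply/allP/idP => /= [H|/eqP ab d _].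
  have Hg : gcdn a b.+1 \in iota 0 b.+2.
    by rewrite mem_iota leq0n add0n ltnS dvdn_leq // dvdn_gcdr.
  by have := H _ Hg; rewrite dvdn_gcdl dvdn_gcdr.
by rewrite -dvdn_gcd ab dvdn1; case: (d == 1).
Qed.

Local Open Scope ring_scope.

Definition rat_split (q : rat) : int * nat := (numq q, `|denq q|%N.-1).
(** Sending unreduced pairs to 0 lets numerator and denominator be read off a code after a
    coprimality test, with no reduction of fractions. *)
Definition rat_join (x : int * nat) : rat :=
  if coprime `|x.1| x.2.+1 then x.1%:~R / x.2.+1%:R else 0.

Lemma rat_splitK : cancel rat_split rat_join.
Proof.
move=> q; have d0 : (0 < `|denq q|)%N by rewrite absz_gt0 denq_neq0.
rewrite /rat_join /= prednK // coprime_num_den -{3}(divq_num_den q).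
by rewrite -[(`|_|%N)%:R]/(`|denq q|%N%:~R) gez0_abs // ltW ?denq_gt0.
Qed.
Instance rep_rat : rep rat := rep_can _ rat_splitK.

Lemma rat_join_num_den x : coprime `|x.1| x.2.+1 ->
  numq (rat_join x) = x.1 /\ denq (rat_join x) = x.2.+1.
Proof.
move=> cx; rewrite /rat_join cx -[x.2.+1%:R]/(Posz x.2.+1)%:~R.
by rewrite coprimeq_num // coprimeq_den //= gtr0_sg // mul1r.
Qed.

Lemma cmp_coprime_int : cmp (fun x : int * nat => coprime `|x.1| x.2.+1).
Proof.
have cp := cmp_comp cmp_pos_part (@cmp_proj1 int nat rep_int rep_nat).
have cn := cmp_comp cmp_neg_part (@cmp_proj1 int nat rep_int rep_nat).
apply: (@cmp_ext _ _ _ _ (fun x => coprime (pos_part x.1 + neg_part x.1) x.2.+1)).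
  by case=> [[m|m] d]; rewrite /= ?addn0 ?add0n.
apply: (cmp_comp (g := fun x : int * nat => ((pos_part x.1 + neg_part x.1)%N, x.2)) cmp_coprime).
cmp_tac.
Qed.

Lemma cmp_numq X {rX : rep X} (q : X -> rat) : cmp q -> cmp (fun x => numq (q x)).
Proof.
have cc := cmp_coprime_int; apply: cmp_comp.
apply: (@cmp_rep_can _ _ _ _ _ _ _ _ _ (fun x : int * nat =>
    if coprime `|x.1| x.2.+1 then x.1 else 0)); first by cmp_tac.
move=> x; case: ifP => c; first by case: (rat_join_num_den c).
by rewrite /rat_join c.
Qed.

Lemma cmp_denq X {rX : rep X} (q : X -> rat) : cmp q -> cmp (fun x => `|denq (q x)|%N).
Proof.
have cc := cmp_coprime_int; move=> cq; apply: (cmp_comp (f := fun q => `|denq q|%N)) cq.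
apply: (@cmp_rep_can _ _ _ _ _ _ _ _ _ (fun x : int * nat =>
    if coprime `|x.1| x.2.+1 then x.2.+1 else 1%N)); first by cmp_tac.
move=> x; case: ifP => c; first by case: (rat_join_num_den c) => _ ->.
by rewrite /rat_join c.
Qed.

Lemma cmp_rat_code X {rX : rep X} (q : X -> rat) : cmp q -> cmp (fun x => rat_code (q x)).
Proof.
move=> cq; have cn := cmp_numq cq; have cd := cmp_denq cq.
apply: (@cmp_ext _ _ _ _ (fun x => pair_code (int_code (numq (q x)))
    (int_code (Posz `|denq (q x)|%N)))).
  by move=> x; rewrite /rat_code gez0_abs // ltW ?denq_gt0.
apply: cmp_pair_code; apply: cmp_int_code => //; exact: cmp_posz.
Qed.

Section Rows.
Context {A : Type} {n : nat}.

Definition row_split (v : 'rV[A]_n) : {ffun 'I_n -> A} := [ffun i => v ord0 i].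
Definition row_join (h : {ffun 'I_n -> A}) : 'rV[A]_n := \row_i h i.
Lemma row_splitK : cancel row_split row_join.
Proof. by move=> v; apply/rowP => i; rewrite mxE ffunE. Qed.
Lemma row_joinK : cancel row_join row_split.
Proof. by move=> h; apply/ffunP => i; rewrite ffunE mxE. Qed.

End Rows.
Instance rep_row A {rA : rep A} n : rep 'rV[A]_n := rep_can _ (@row_splitK A n).

Lemma cmp_row A X {rA : rep A} {rX : rep X} n (v : X -> 'rV[A]_n) i :
  cmp v -> cmp (fun x => v x ord0 i).
Proof.
move=> cv; apply: (@cmp_ext _ _ _ _ (fun x => row_split (v x) i)).
  by move=> x; rewrite ffunE.
exact: cmp_ffun_app (cmp_of_can (@row_joinK A n) cv).
Qed.

Lemma cmp_all_const X {rX : rep X} (I : Type) (s : seq I) (p : X -> I -> bool) :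
  (forall i, cmp (fun x => p x i)) -> cmp (fun x => all (p x) s).
Proof.
by move=> cp; elim: s => [|i s IH] /=; [exact: cmp_const | exact: cmp_andb (cp i) IH].
Qed.

Lemma cmp_map_const A X {rA : rep A} {rX : rep X} (I : Type) (s : seq I) (f : X -> I -> A) :
  (forall i, cmp (fun x => f x i)) -> cmp (fun x => map (f x) s).
Proof.
by move=> cf; elim: s => [|i s IH] /=; [exact: cmp_const | exact: cmp_cons (cf i) IH].
Qed.

Instance ceq_row (A : eqType) {rA : rep A} {eA : ceq A} n : ceq 'rV[A]_n.
Proof.
apply: (@cmp_ext _ _ _ _ (fun x : 'rV[A]_n * 'rV[A]_n =>
    all (fun i => x.1 ord0 i == x.2 ord0 i) (enum 'I_n))).
  move=> [u v] /=; apply/allP/eqP => [H|-> //].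
  by apply/rowP => i; apply/eqP; apply: H; rewrite mem_enum.
apply: cmp_all_const => i.
have c1 : cmp (fun x : 'rV[A]_n * 'rV[A]_n => x.1 ord0 i).
  by apply: cmp_row; exact: cmp_proj1.
have c2 : cmp (fun x : 'rV[A]_n * 'rV[A]_n => x.2 ord0 i).
  by apply: cmp_row; exact: cmp_proj2.
exact: cmp_eq c1 c2.
Qed.

Lemma cmp_vec_code n X {rX : rep X} (q : X -> 'rV[rat]_n) :
  cmp q -> cmp (fun x => vec_code (q x)).
Proof.
move=> cq; apply: cmp_seq_code; apply: cmp_map_const => i.
by apply: cmp_rat_code; exact: cmp_row.
Qed.

Lemma cmp_set_code n X {rX : rep X} (s : X -> seq 'rV[rat]_n) :
  cmp s -> cmp (fun x => seq_code [seq vec_code q | q <- s x]).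
Proof.
move=> cs; apply: cmp_seq_code; apply: cmp_map => //.
by apply: cmp_vec_code; exact: cmp_proj2.
Qed.

(** * The outer measure kappa *)

Local Open Scope classical_set_scope.

Lemma computes_fun U p v w : computes U p v -> computes U p w -> v = w.
Proof.
move=> /tm_resultP[s Es] /tm_resultP[t Et].
have := tm_result_mono (leq_maxl s t) Es.
by rewrite (tm_result_mono (leq_maxr s t) Et) => -[].
Qed.

Lemma prefix_rcons_or (r p : bitstring) : prefix r p -> r != p ->
  prefix (rcons r false) p || prefix (rcons r true) p.
Proof.
case/prefixP => -[|b s] ->; first by rewrite cats0 eqxx.
move=> _; rewrite -cat_rcons; case: b; rewrite prefix_prefix ?orbT //.
Qed.

(** Induction on the depth [d] left below a node [r] of the binary tree: either [r] is a codeword,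
    and then the only one below itself, or the sum splits between its two children. *)
Lemma kraft_inequality (F : realFieldType) (ps : seq bitstring) :
  uniq ps -> (forall p q, p \in ps -> q \in ps -> prefix p q -> p = q) ->
  \sum_(p <- ps) 2 ^- size p <= 1 :> F.
Proof.
move=> ups pfree; have inv_ge0 n : 0 <= 2 ^- n :> F by rewrite invr_ge0 exprn_ge0.
have below d r : (forall p, p \in ps -> size p <= size r + d)%N ->
    \sum_(p <- ps | prefix r p) 2 ^- size p <= 2 ^- size r :> F.
  elim: d r => [|d IH] r len; have [rps|rps] := boolP (r \in ps).
  - rewrite big_mkcond (bigD1_seq r) //= prefix_refl big_seq_cond big1 ?addr0 // => p.
    by case/andP => pps pr; case: ifP => // /(pfree _ _ rps pps) E; rewrite E eqxx in pr.
  - rewrite big_seq_cond big1 // => p /andP[pps /prefixP[s ps_]].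
    have := len _ pps; rewrite ps_ size_cat leq_add2l leqn0 size_eq0 => /eqP s0.
    by move: pps rps; rewrite ps_ s0 cats0 => ->.
  - rewrite big_mkcond (bigD1_seq r) //= prefix_refl big_seq_cond big1 ?addr0 // => p.
    by case/andP => pps pr; case: ifP => // /(pfree _ _ rps pps) E; rewrite E eqxx in pr.
  apply: (@le_trans _ _ (\sum_(p <- ps | prefix (rcons r false) p) 2 ^- size p +
      \sum_(p <- ps | prefix (rcons r true) p) 2 ^- size p)).
    rewrite big_mkcond [X in _ <= X + _]big_mkcond [X in _ <= _ + X]big_mkcond.
    rewrite -big_split /= big_seq [leRHS]big_seq; apply: ler_sum => p pps.
    case: ifP => rp; last by case: ifP => _; case: ifP => _; rewrite ?addr0 ?add0r ?addr_ge0.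
    have /(prefix_rcons_or rp)/orP[->|->] : r != p by apply: contraNneq rps => ->.
      by case: ifP => _; rewrite ?addr0 // lerDl.
    by case: ifP => _; rewrite ?add0r // lerDr.
  have -> : 2 ^- size r = 2 ^- (size r).+1 + 2 ^- (size r).+1 :> F.
    by rewrite exprS; field; rewrite expf_neq0 // pnatr_eq0.
  apply: lerD; [rewrite -(size_rcons r false) | rewrite -(size_rcons r true)];
    by apply: IH => p /len; rewrite size_rcons addSnnS.
rewrite (_ : \sum_(p <- ps) _ = \sum_(p <- ps | prefix [::] p) 2 ^- size p); last first.
  by apply: eq_bigl => p; rewrite prefix0s.
apply: le_trans (below (\max_(p <- ps) size p)%N [::] _) _; last by rewrite expr0 invr1.
by move=> p pps; rewrite add0n; exact: leq_bigmax_seq.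
Qed.

Section Kappa.
Variables (R : realType) (n : nat) (U : turing_machine).
Implicit Types (E : set 'rV[R]_n) (q : 'rV[rat]_n).

Lemma ratvec_inj : injective (@ratvec R n).
Proof.
move=> u v E; apply/rowP => i; move/rowP: E => /(_ i).
by rewrite !mxE => /fmorph_inj.
Qed.

Lemma powR2N k : 2 `^ (- k%:R) = 2 ^- k :> R.
Proof. by rewrite powRN powR_mulrn. Qed.

Lemma kappa_ge E q p : E (ratvec R q) -> computes U p (vec_code q) ->
  ((2 ^- size p)%:E <= kappa R n U E)%E.
Proof.
move=> Eq cp; rewrite -powR2N -[X in (X <= _)%E]/(exp2N (size p)%:R%:E).
apply: le_exp2N; apply: (@le_trans _ _ (vec_complexity R U q)).
  by apply: ereal_inf_lbound; exists q.
by apply: ereal_inf_lbound; exists p.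
Qed.

Lemma kappa_attained E : kappa R n U E = 0%E \/
  exists p q, [/\ E (ratvec R q), computes U p (vec_code q) &
    kappa R n U E = (2 ^- size p)%:E].
Proof.
have [E0|[k Ek]] := set_complexity_nat U E; first by left; rewrite /kappa E0.
right; set S := [set vec_complexity R U q | q in [set q | E (ratvec R q)]].
have S0 : S !=set0.
  by apply/set0P/eqP => S0; move: Ek; rewrite /set_complexity -/S S0 ereal_inf0.
have [|q Eq Kq] := ereal_inf_nat_attained _ S0.
  by move=> _ [q _ <-]; exact: vec_complexity_nat.
rewrite -[ereal_inf S]/(set_complexity U E) Ek in Kq.
set P := [set (size p)%:R%:E | p in [set p | computes U p (vec_code q)]] : set (\bar R).
have P0 : P !=set0.
  apply/set0P/eqP => P0; move: Kq; rewrite /vec_complexity /string_complexity -/P P0.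
  by rewrite ereal_inf0.
have [|p cp Kp] := ereal_inf_nat_attained _ P0; first by move=> _ [p _ <-]; right; exists (size p).
rewrite -[ereal_inf P]/(vec_complexity R U q) Kq in Kp.
by exists p, q; split => //; rewrite /kappa Ek -Kp /= powR2N.
Qed.

Lemma kappa_point q : kappa R n U [set ratvec R q] = 0%E \/
  exists p, computes U p (vec_code q) /\ kappa R n U [set ratvec R q] = (2 ^- size p)%:E.
Proof.
have [->|[p [q' [/ratvec_inj -> cp ->]]]] := kappa_attained [set ratvec R q].
  by left.
by right; exists p.
Qed.

Lemma kappa_strongly_finite : prefix_machine U -> strongly_finite (kappa R n U).
Proof.
move=> Upf; split.
  rewrite /rationally_supported; have [//|[p [q [nq _ _]]]] := kappa_attained (~` rational_points R n).
  by exfalso; apply: nq; exists q.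
suff le1 : (\esum_(q in [set: 'rV[rat]_n]) kappa R n U [set ratvec R q] <= 1)%E.
  by apply: (le_lt_trans le1); rewrite ltry.
apply: ge_ereal_sup => _ [A [finA _] <-].
have /choice[P PE] : forall q, exists o : option bitstring,
    (forall p, o = Some p -> computes U p (vec_code q)) /\
    kappa R n U [set ratvec R q] = (oapp (fun p => 2 ^- size p) 0 o)%:E.
  move=> q; have [->|[p [cp ->]]] := kappa_point q; first by exists None.
  by exists (Some p); split => // _ [<-].
rewrite fsbig_finite //; under eq_bigr do rewrite (PE _).2.
rewrite sumEFin lee_fin -[X in X <= _]big_pmap.
have memP p : p \in pmap P (fset_set A) -> exists2 q, q \in fset_set A & P q = Some p.
  by rewrite mem_pmap => /mapP[q qA ->]; exists q.
apply: kraft_inequality => [|p1 p2 /memP[q1 _ /(PE q1).1 c1] /memP[q2 _ /(PE q2).1 c2]].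
  elim: (enum_fset _) (fset_uniq (fset_set A)) => //= q s IH /andP[qs /IH us].
  case E: (P q) => [p|] //=; rewrite us andbT mem_pmap; apply/mapP => -[q' q's E'].
  have := computes_fun ((PE q).1 _ E) ((PE q').1 _ (esym E')).
  by move/vec_code_inj => qq'; rewrite qq' q's in qs.
by apply: Upf; [exists (vec_code q1) | exists (vec_code q2)].
Qed.

Lemma pow2N_lt (eps : R) : 0 < eps -> exists k, 2 ^- k < eps.
Proof.
move=> eps0; have [k kE] : exists k : nat, eps^-1 < k%:R.
  by exists (Num.bound eps^-1); apply: archi_boundP; rewrite invr_ge0 ltW.
exists k; rewrite invf_plt ?posrE ?exprn_gt0 //; apply: (lt_trans kE).
by rewrite -natrX ltr_nat ltn_expl.
Qed.

Lemma bitstrings_finite k : exists ps : seq bitstring,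
  forall p, (size p <= k)%N -> p \in ps.
Proof.
elim: k => [|k [ps psE]]; first by exists [:: [::]] => -[].
exists ([::] :: [seq b :: p | b <- [:: false; true], p <- ps]) => -[|b p] // /psE pps.
by rewrite inE; apply/orP; right; apply/allpairsP; exists (b, p); split => //; case: (b).
Qed.

(** A point that no program of length at most [k] produces has complexity above [k], and only
    finitely many points are produced by such programs. *)
Lemma kappa_finitely_supported : finitely_supported (kappa R n U).
Proof.
move=> eps /pow2N_lt[k keps]; have [ps psE] := bitstrings_finite k.
have /choice[Q QE] : forall p, exists q, (exists q, computes U p (vec_code q)) ->
    computes U p (vec_code q).
  move=> p; have [[q cq]|nq] := pselect (exists q, computes U p (vec_code q)).
    by exists q.
  by exists 0 => /nq.
exists [fset Q p | p in ps]%fset; set A := [fset Q p | p in ps]%fset.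
rewrite -[X in (X < _)%E]/(kappa R n U (~` finset_points R A)).
have [->|[p [q [nq cp ->]]]] := kappa_attained (~` finset_points R A).
  by rewrite lte_fin (lt_trans _ keps) // invr_gt0 exprn_gt0.
rewrite lte_fin; apply: le_lt_trans keps; rewrite lef_pV2 ?posrE ?exprn_gt0 //.
rewrite ler_weXn2l ?ler1n // leqNgt; apply/negP => /ltnW /psE pps; apply: nq.
exists q => //; have <- : Q p = q.
  by apply/vec_code_inj/(computes_fun _ cp); apply: QE; exists q.
by apply/imfsetP; exists p.
Qed.

(** ** Approximation from below *)

Definition produces (s : seq 'rV[rat]_n) (t i : nat) : bool :=
  if tm_result U t (dec i) is Some v then v \in [seq vec_code q | q <- s] else false.

Definition code_size (i : nat) : nat := size (dec i : bitstring).

Definition best_size (s : seq 'rV[rat]_n) (t : nat) : option nat :=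
  foldr (fun i o => if produces s t i then
      Some (if o is Some m then if (code_size i <= m)%N then code_size i else m
        else code_size i)
    else o) None (iota 0 t).

Definition kappa_approx (s : seq 'rV[rat]_n) (t : nat) : rat :=
  if best_size s t is Some m then 2 ^- m else 0.

Lemma best_sizeP s t m : best_size s t = Some m ->
  exists i, [/\ (i < t)%N, produces s t i & code_size i = m].
Proof.
rewrite /best_size; have : all (fun i => i < t)%N (iota 0 t).
  by apply/allP => i; rewrite mem_iota.
elim: (iota 0 t) m => //= i r IH m /andP[it {}/IH IH].
case: ifP => [pi|_]; last exact: IH.
case E: (foldr _ _ _) IH => [m'|] IH [<-]; last by exists i.
by case: ifP => _; [exists i | exact: IH].
Qed.

Lemma best_size_le s t i : (i < t)%N -> produces s t i ->
  exists2 m, best_size s t = Some m & (m <= code_size i)%N.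
Proof.
move=> it pi; have : i \in iota 0 t by rewrite mem_iota.
rewrite /best_size; elim: (iota 0 t) => //= j r IH; rewrite inE => /predU1P[<-|/IH[m -> mi]].
  rewrite pi; eexists; first by [].
  by case: (foldr _ _ _) => // m; case: ifP => // /negbT; rewrite -ltnNge => /ltnW.
case: ifP => _; last by exists m.
eexists; first by [].
by have [jm|//] := boolP (code_size j <= m)%N; exact: leq_trans jm mi.
Qed.

Lemma producesP s t i : produces s t i ->
  exists2 q, q \in s & computes U (dec i) (vec_code q).
Proof.
rewrite /produces; case E: (tm_result _ _ _) => [v|] // /mapP[q qs vq].
by exists q => //; apply/tm_resultP; exists t; rewrite E vq.
Qed.

Lemma produces_mono s t u i : (t <= u)%N -> produces s t i -> produces s u i.
Proof.
move=> tu; rewrite /produces; case E: (tm_result U t _) => [v|] //.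
by rewrite (tm_result_mono tu E).
Qed.

Lemma kappa_approx_eq s s' t : s =i s' -> best_size s t = best_size s' t.
Proof.
move=> ss'; rewrite /best_size.
suff -> : produces s t = produces s' t by [].
apply/funext => i; rewrite /produces; case: (tm_result _ _ _) => // v.
exact: eq_mem_map.
Qed.

Lemma cmp_produces : cmp (fun x : (seq 'rV[rat]_n * nat) * nat => produces x.1.1 x.1.2 x.2).
Proof.
have cdec : cmp (rA := rep_nat) (fun i => dec i : bitstring).
  by exists id => //; exact: ncomp_id.
have cr : cmp (fun x : (seq 'rV[rat]_n * nat) * nat => tm_result U x.1.2 (dec x.2)).
  by apply: cmp_tm_result; cmp_tac.
have cv : cmp (fun q : 'rV[rat]_n => vec_code q) by apply: cmp_vec_code; exact: cmp_id.
rewrite /produces; eapply cmp_opt => //; last by cmp_tac.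
eapply cmp_mem; [exact: ceq_seq | cmp_tac | cmp_tac].
Qed.

Lemma cmp_best_size : cmp (fun x : seq 'rV[rat]_n * nat => best_size x.1 x.2).
Proof.
have cdec : cmp (rA := rep_nat) (fun i => dec i : bitstring).
  by exists id => //; exact: ncomp_id.
have cp := cmp_produces.
have cs : cmp code_size by rewrite /code_size; cmp_tac.
rewrite /best_size; eapply cmp_foldr; [|cmp_tac|cmp_tac].
eapply cmp_if; [|cmp_tac|cmp_tac].
by apply: (cmp_comp (g := fun y : (seq 'rV[rat]_n * nat) * (nat * option nat) =>
  (y.1, y.2.1)) cp); cmp_tac.
Qed.

Lemma rat_code_pow2N k : rat_code (2 ^- k) = pair_code (int_code 1) (int_code (2 ^ k)%N).
Proof.
have -> : 2 ^- k = 1%:~R / (Posz (2 ^ k))%:~R :> rat.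
  by rewrite div1r -[(Posz _)%:~R]/((2 ^ k)%N%:R) natrX.
have c : coprime `|1%:Z| `|Posz (2 ^ k)| by rewrite coprime1n.
rewrite /rat_code coprimeq_num // coprimeq_den // gtr0_sg ?ltz_nat ?expn_gt0 //.
by rewrite mulr1 eqz_nat expn_eq0.
Qed.

(** The approximation is 0 or a power of 2, so its code is built from the exponent without rational
    arithmetic. *)
Definition approx_code (o : option nat) : bitstring :=
  if o is Some m then pair_code (int_code 1) (int_code (2 ^ m)%N) else rat_code 0.

Lemma approx_codeE s t : approx_code (best_size s t) = rat_code (kappa_approx s t).
Proof.
by rewrite /kappa_approx; case: (best_size s t) => //= m; rewrite rat_code_pow2N.
Qed.

Definition approx_input (s : seq 'rV[rat]_n) (t : nat) : bitstring :=
  pair_code (seq_code [seq vec_code q | q <- s]) (nat_code t).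

Lemma cmp_approx_input X {rX : rep X} (s : X -> seq 'rV[rat]_n) (t : X -> nat) :
  cmp s -> cmp t -> cmp (fun x => approx_input (s x) (t x)).
Proof.
by move=> cs ct; apply: cmp_pair_code; [exact: cmp_set_code | exact: cmp_nat_code].
Qed.

Lemma approx_input_inj s t s' t' :
  approx_input s t = approx_input s' t' -> s = s' /\ t = t'.
Proof.
move=> /pair_code_inj[/seq_code_inj E /nat_code_inj ->]; split => //.
exact: (inj_map (@vec_code_inj n) E).
Qed.

(** Decoding by search: the stage [i] is itself a code of a candidate input, encoded and compared
    with [x]. *)
Definition approx_search (i : nat) (x : bitstring) : option bitstring :=
  let y : seq 'rV[rat]_n * nat := dec i in
  if approx_input y.1 y.2 == x then Some (approx_code (best_size y.1 y.2)) else None.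

Lemma cmp_dec A {rA : rep A} : cmp (rA := rep_nat) (fun i => dec i : A).
Proof. by exists id => //; exact: ncomp_id. Qed.

Lemma cmp_approx_search : cmp (fun x : nat * bitstring => approx_search x.1 x.2).
Proof.
have cname : cmp (fun y : seq 'rV[rat]_n * nat => approx_input y.1 y.2).
  by apply: cmp_approx_input; cmp_tac.
have cb := cmp_best_size.
have ccode : cmp approx_code.
  eapply cmp_opt; [exact: cmp_id | | exact: cmp_const].
  apply: cmp_pair_code; first exact: cmp_const.
  by apply: cmp_int_code; apply: cmp_posz; apply: cmp_expn; cmp_tac.
have cD : cmp (rA := rep_nat) (fun i => dec i : seq 'rV[rat]_n * nat) by exact: cmp_dec.
rewrite /approx_search; cmp_tac.
Qed.

Lemma kappa_approx_computable :
  computable_approx (fun (A : {fset 'rV[rat]_n}) t => kappa_approx A t).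
Proof.
have [M [_ MP]] := search_machine cmp_approx_search; exists M => A t w [s [sA ->]].
have ex : exists i, isSome (approx_search i (approx_input s t)).
  by exists (enc (s, t)); rewrite /approx_search encK /= eqxx.
have [i fi imin] := ex_minnP ex; apply: (MP _ i); last first.
  by move=> j ji; case E: approx_search => //; have := imin j; rewrite E leqNgt ji => /(_ isT).
move: fi; rewrite /approx_search; case: eqP => // /approx_input_inj[-> ->] _.
by rewrite approx_codeE /kappa_approx (kappa_approx_eq _ sA).
Qed.

Lemma finset_pointsE (A : {fset 'rV[rat]_n}) q : finset_points R A (ratvec R q) <-> q \in A.
Proof. by split=> [[q' q'A /ratvec_inj <-]|qA] //; exists q. Qed.

Lemma ratr_pow2N k : ratr (2 ^- k) = 2 ^- k :> R.
Proof. by rewrite fmorphV rmorphXn /= ratr_nat. Qed.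

Lemma kappa_lower_semicomputable : lower_semicomputable (kappa R n U).
Proof.
split; first exact: kappa_finitely_supported.
exists (fun A t => kappa_approx A t).
have ge0 (s : seq 'rV[rat]_n) t : 0 <= kappa_approx s t.
  by rewrite /kappa_approx; case: (best_size s t) => // m; rewrite invr_ge0 exprn_ge0.
have le_kappa (A : {fset 'rV[rat]_n}) t :
    ((ratr (kappa_approx A t) : R)%:E <= kappa R n U (finset_points R A))%E.
  rewrite /kappa_approx; case E: (best_size A t) => [m|]; last by rewrite rmorph0 kappa_ge0.
  have [i [_ /producesP[q qA cq] im]] := best_sizeP E.
  by rewrite ratr_pow2N -im; apply: kappa_ge cq; apply/finset_pointsE.
split=> [||A s t st|A].
- exact: kappa_approx_computable.
- by move=> A t; exact: ge0.
- split=> //; rewrite {1}/kappa_approx; case E: (best_size A s) => [m|] //.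
  have [i [it pi im]] := best_sizeP E.
  have [m' E' m'm] := best_size_le (leq_trans it st) (produces_mono st pi).
  rewrite /kappa_approx E' lef_pV2 ?posrE ?exprn_gt0 // ler_weXn2l ?ler1n //.
  by rewrite -im.
(* The approximation is eventually constant: it is exact once a shortest program has been enumerated
   and run until it halts. *)
- apply: cvg_near_cst; have [K0|[p [q [qA cp Kp]]]] := kappa_attained (finset_points R A).
    near=> t; apply/eqP; rewrite eq_le le_kappa /= -[leLHS]/(kappa R n U _) K0 lee_fin.
    by rewrite ler0q.
  have [t0 Et0] : exists t0, tm_result U t0 p = Some (vec_code q) by apply/tm_resultP.
  near=> t; apply/eqP; rewrite eq_le le_kappa /= -[leLHS]/(kappa R n U _) Kp.
  have t0t : (t0 <= t)%N by near: t; exists t0.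
  have pt : (enc p < t)%N by near: t; exists (enc p).+1.
  have pp : produces A t (enc p).
    rewrite /produces encK (tm_result_mono t0t Et0) map_f //.
    by apply/finset_pointsE.
  have [m E mp] := best_size_le pt pp; rewrite /code_size encK in mp.
  rewrite /kappa_approx E ratr_pow2N lee_fin lef_pV2 ?posrE ?exprn_gt0 //.
  by rewrite ler_weXn2l ?ler1n.
Unshelve. all: by end_near.
Qed.

End Kappa.

(** * Domination on dyadic cubes *)

(** For [v > 1] the full geometric series is below 2. For [v <= 1] the term [k = 0] is absent, and
    shifting the index turns the sum into half of the sum for [2 * v]. *)
Lemma sum_pow2N_lt (F : realFieldType) K (v : F) : 0 <= v ->
  \sum_(k <- iota 0 K | 2 ^- k < v) 2 ^- k <= 2 * v.
Proof.
elim: K v => [|K IH] v v0; first by rewrite big_nil mulr_ge0.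
have full L : \sum_(k <- iota 0 L) 2 ^- k <= 2 - 2 ^- L * 2 :> F.
  elim: L => [|L IHL]; first by rewrite big_nil expr0 invr1 mul1r subrr.
  rewrite -[L.+1]addn1 iotaD big_cat big_seq1 /= add0n addn1.
  apply: (le_trans (lerD IHL (lexx _))); rewrite exprS.
  by rewrite invfM; lra.
have [v1|v1] := ltP 1 v.
  apply: (@le_trans _ _ (\sum_(k <- iota 0 K.+1) 2 ^- k)).
    by rewrite [leLHS]big_mkcond; apply: ler_sum => k _; case: ifP.
  apply: (le_trans (full _)); have : 0 <= 2 ^- K.+1 :> F by rewrite invr_ge0 exprn_ge0.
  by lra.
rewrite [iota _ _]/= big_cons expr0 invr1 ltNge v1 /= -[1%N]addn0 iotaDl big_map.
have := IH (2 * v) _; rewrite mulr_ge0 // => /(_ isT) le2.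
apply: (@le_trans _ _ (2^-1 * \sum_(k <- iota 0 K | 2 ^- k < 2 * v) 2 ^- k)); last by lra.
rewrite mulr_sumr [leLHS]big_mkcond [leRHS]big_mkcond; apply: ler_sum => k _ /=.
rewrite add1n exprS invfM; case: (ltP (2 ^- k) (2 * v)) => h; case: ifP => h' //.
by move: h' h; lra.
Qed.

(** What matters is that the reciprocals are summable while the logarithm is [o(r)]; this choice
    telescopes. *)
Definition cube_weight (r : nat) : nat := r.+1 * r.+2.

Lemma sum_cube_weight (F : realFieldType) N :
  \sum_(r <- iota 0 N) (cube_weight r)%:R^-1 <= 1 :> F.
Proof.
suff -> : \sum_(r <- iota 0 N) (cube_weight r)%:R^-1 = 1 - N.+1%:R^-1 :> F.
  by rewrite gerBl invr_ge0 ler0n.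
elim: N => [|N IH]; first by rewrite big_nil invr1 subrr.
rewrite -[in iota _ _]addn1 iotaD big_cat big_seq1 IH /= add0n /cube_weight natrM.
rewrite -[N.+2%:R]natr1; field.
by rewrite !nat1r natr1 !pnatr_eq0.
Qed.

Lemma ler_sum_subset (F : realFieldType) (I : eqType) (s t : seq I) (P : pred I)
    (f : I -> F) : uniq s -> uniq t -> (forall i, i \in s -> P i /\ i \in t) ->
  (forall i, 0 <= f i) -> \sum_(i <- s) f i <= \sum_(i <- t | P i) f i.
Proof.
move=> us ut st f0; have p : perm_eq s [seq i <- t | i \in s].
  apply: uniq_perm => //; first exact: filter_uniq.
  by move=> i; rewrite mem_filter; case: (boolP (i \in s)) => // /st[_ ->].
rewrite (perm_big _ p) big_filter big_mkcond [leRHS]big_mkcond; apply: ler_sum => i _.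
by case: ifP => [/st[-> //]|_]; case: ifP.
Qed.

(** * Rational points in dyadic cubes *)

Section CubeTest.
Variables (R : realType) (n : nat).

(** The inequalities [m_i <= 2^r q_i < m_i + 1] with denominators cleared and negative parts moved
    across, so that only arithmetic on naturals remains. *)
Definition cube_test (r : nat) (m : 'rV[int]_n) (q : 'rV[rat]_n) : bool :=
  all (fun i => let d := `|denq (q ord0 i)|%N in
    (pos_part (m ord0 i) * d + 2 ^ r * neg_part (numq (q ord0 i)) <=
     2 ^ r * pos_part (numq (q ord0 i)) + neg_part (m ord0 i) * d)%N &&
    (2 ^ r * pos_part (numq (q ord0 i)) + neg_part (m ord0 i) * d <
     pos_part (m ord0 i) * d + d + 2 ^ r * neg_part (numq (q ord0 i)))%N) (enum 'I_n).

Lemma cmp_cube_test X {rX : rep X} (r : X -> nat) (m : X -> 'rV[int]_n)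
    (q : X -> 'rV[rat]_n) : cmp r -> cmp m -> cmp q ->
  cmp (fun x => cube_test (r x) (m x) (q x)).
Proof.
move=> cr cm cq; apply: cmp_all_const => i; cbv zeta.
have cd := cmp_denq (cmp_row i cq); have cn := cmp_numq (cmp_row i cq).
have cmi := cmp_row i cm; have cp := cmp_pos_part; have cg := cmp_neg_part.
cmp_tac.
Qed.

Lemma intE_parts (z : int) : z%:~R = (pos_part z)%:R - (neg_part z)%:R :> R.
Proof. by case: z => k /=; rewrite ?subr0 ?sub0r // NegzE mulrNz. Qed.

Lemma cube_testP r m q : cube_test r m q <-> dyadic_cube r m (ratvec R q).
Proof.
have two : 2 ^+ r != 0 :> R by rewrite expf_neq0 // pnatr_eq0.
have coord i : ((m ord0 i)%:~R <= 2 ^+ r * (ratr (q ord0 i) : R) < (m ord0 i + 1)%:~R) =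
    (let d := `|denq (q ord0 i)|%N in
    (pos_part (m ord0 i) * d + 2 ^ r * neg_part (numq (q ord0 i)) <=
     2 ^ r * pos_part (numq (q ord0 i)) + neg_part (m ord0 i) * d)%N &&
    (2 ^ r * pos_part (numq (q ord0 i)) + neg_part (m ord0 i) * d <
     pos_part (m ord0 i) * d + d + 2 ^ r * neg_part (numq (q ord0 i)))%N).
  set z := m ord0 i; set x := q ord0 i; move=> /=.
  have d0 : 0 < `|denq x|%N%:R :> R by rewrite ltr0n absz_gt0 denq_neq0.
  have -> : ratr x = (numq x)%:~R / `|denq x|%N%:R :> R.
    rewrite /ratr; congr (_ / _); rewrite -[(`|_|%N)%:R]/(`|denq x|%N%:~R).
    by rewrite gez0_abs // ltW ?denq_gt0.
  rewrite intrD mulr1z mulrA ler_pdivlMr // ltr_pdivrMr // !intE_parts.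
  rewrite -(ler_nat R) -(ltr_nat R) !natrD !natrM !natrX.
  by congr (_ && _); apply/idP/idP; lra.
split=> [/allP H|[x xm xq]].
  exists (2 ^+ r *: ratvec R q); last by rewrite scalerA mulVf // scale1r.
  by move=> i; rewrite !mxE coord; apply: H; rewrite mem_enum.
apply/allP => i _; rewrite -coord; have := xm i.
have <- : 2 ^+ r * ratr (q ord0 i) = x ord0 i; last by [].
have := congr1 (fun v : 'rV[R]_n => v ord0 i) xq; rewrite !mxE => <-.
by rewrite mulrA mulfV // mul1r.
Qed.

Lemma cube_test_uniq r m m' q : cube_test r m q -> cube_test r m' q -> m = m'.
Proof.
move=> /cube_testP[x xm xq] /cube_testP[x' xm' xq'].
have xx : x = x'.
  have two : 2 ^- r != 0 :> R by rewrite invr_neq0 // expf_neq0 // pnatr_eq0.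
  by apply: (scalerI two); rewrite xq xq'.
apply/rowP => i; have /andP[a b] := xm i; have := xm' i; rewrite -xx => /andP[a' b'].
have := le_lt_trans a b'; have := le_lt_trans a' b; rewrite !ltr_int !ltzD1.
by move=> h1 h2; apply/eqP; rewrite eq_le h1 h2.
Qed.

End CubeTest.

(** Twice the bound [ln (r+2) = 2 ln sqrt(r+2) <= 2 sqrt(r+2)] makes the exponent at most a constant
    times [sqrt(r+2)], which reduces the little-o to a polynomial inequality. *)
Lemma exp2_littleo_weight (R : realType) d :
  @exp2_littleo R (fun r => 2 ^- d / (cube_weight r)%:R).
Proof.
have ln2 : 0 < ln 2 :> R by rewrite ln_gt0 // ltr1n.
have w0 r : 0 < (cube_weight r)%:R :> R by rewrite ltr0n.
exists (fun r => d%:R + ln (cube_weight r)%:R / ln 2); last first.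
  move=> r; rewrite opprD powRD; last by rewrite pnatr_eq0 implybT.
  rewrite powRN powR_mulrn //; congr (_ * _).
  rewrite powRN /powR pnatr_eq0 /= -mulrA mulVf ?gt_eqF // mulr1.
  by rewrite lnK ?posrE ?w0.
apply/eqoP => eps eps0.
pose K : R := d%:R + 4 / ln 2.
have K0 : 0 < K by rewrite ltr_wpDl ?ler0n // divr_gt0.
have bound r : d%:R + ln (cube_weight r)%:R / ln 2 <= K * Num.sqrt r.+2%:R.
  have s1 : 1 <= Num.sqrt r.+2%:R :> R.
    by rewrite -[leLHS]sqrtr1 ler_sqrt ?ltr0n // ler1n.
  have lns : ln r.+2%:R <= 2 * Num.sqrt r.+2%:R :> R.
    rewrite -{1}[r.+2%:R]sqr_sqrtr ?ler0n // lnXn; last exact: lt_le_trans s1.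
    rewrite -[X in X <= _]mulr_natl ler_wpM2l //.
    have := @le_ln1Dx R (Num.sqrt r.+2%:R - 1); rewrite [1 + _]addrC subrK.
    by move=> h; apply: (le_trans (h _)); lra.
  rewrite /cube_weight natrM lnM ?posrE ?ltr0n //.
  have l12 : ln r.+1%:R <= ln r.+2%:R :> R by rewrite ler_ln ?posrE ?ltr0n // ler_nat.
  rewrite /K [leRHS]mulrDl; apply: lerD; first by rewrite ler_peMr ?ler0n.
  rewrite mulrAC ler_pM2r ?invr_gt0 //; lra.
near=> r.
have r0 : 0 <= d%:R + ln (cube_weight r)%:R / ln 2 :> R.
  by rewrite addr_ge0 ?ler0n // divr_ge0 ?ln_ge0 ?ler1n // ltW.
rewrite (ger0_norm r0) ger0_norm ?ler0n //; apply: (le_trans (bound r)).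
(* Squaring turns the goal into [K^2 (r+2) <= eps^2 r^2]; since [r + 2 <= 3 r] for [r >= 1], this
   threshold suffices. *)
have rK : 3 * K ^+ 2 / eps ^+ 2 <= r%:R.
  near: r; exists (Num.bound (3 * K ^+ 2 / eps ^+ 2)) => // k /= hk.
  apply: (le_trans (ltW (archi_boundP _))); last by rewrite ler_nat.
  by apply: divr_ge0; [apply: mulr_ge0 => // |]; exact: sqr_ge0.
have r1 : 1 <= r%:R :> R by near: r; exists 1%N => // k /= hk; rewrite ler1n.
rewrite -(@ler_pXn2r _ 2) ?nnegrE ?mulr_ge0 ?sqrtr_ge0 ?ler0n ?(ltW K0) ?(ltW eps0) //.
rewrite !exprMn sqr_sqrtr ?ler0n // (_ : r.+2%:R = r%:R + 2); last by rewrite -addn2 natrD.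
move: rK; rewrite ler_pdivrMr ?exprn_gt0 // => rK.
have : 0 <= r%:R * (r%:R * eps ^+ 2 - 3 * K ^+ 2).
  by rewrite mulr_ge0 ?ler0n // subr_ge0.
have : 0 <= K ^+ 2 * (r%:R - 1) by rewrite mulr_ge0 ?sqr_ge0 // subr_ge0.
by nra.
Unshelve. all: by end_near.
Qed.

(** * Codeword requests for cubes and their Kraft sum *)

Section Requests.
Variables (R : realType) (n : nat).
Variables (nu : {outer_measure set 'rV[R]_n -> \bar R}) (N : turing_machine).
Variable nuhat : {fset 'rV[rat]_n} -> nat -> rat.
Hypothesis nu_mass : (\esum_(q in [set: 'rV[rat]_n]) nu [set ratvec R q] < +oo)%E.
Hypothesis nu_support : finitely_supported nu.
Hypothesis nuhat_computed : forall A t w, finset_name A w ->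
  computes N (pair_code w (nat_code t)) (rat_code (nuhat A t)).
Hypothesis nuhat_ge0 : forall A t, 0 <= nuhat A t.
Hypothesis nuhat_le : forall A t, ((ratr (nuhat A t) : R)%:E <= nu (finset_points R A))%E.
Hypothesis nuhat_cvg : forall A, (fun t => (ratr (nuhat A t) : R)%:E) @ \oo -->
  nu (finset_points R A).

(** The point to be output is not part of the key: all confirmations of one bound for one cube share
    a codeword and are counted once. *)
Local Notation request_key := (nat * 'rV[int]_n * nat)%type.

(* A request for a codeword of length about [k] for the cube with address [m] at
   level [r]: a point [q] to be output, a list [s] of points of the cube, and
   [t], [steps], [a], [b] such that the machine shows in [steps] steps that the
   [t]-th approximation of the measure of [s] is [a / b]. *)
Local Notation request_data :=
  (request_key * ('rV[rat]_n * seq 'rV[rat]_n) * ((nat * nat) * (nat * nat)))%type.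

Definition frac_code (a b : nat) : bitstring :=
  pair_code (int_code (Posz a)) (int_code (Posz b)).

Definition confirms (s : seq 'rV[rat]_n) (t steps a b : nat) : bool :=
  if tm_result N steps (approx_input s t) is Some v then v == frac_code a b else false.

Definition granted (d : request_data) : bool :=
  let r := d.1.1.1.1 in let m := d.1.1.1.2 in let k := d.1.1.2 in
  let q := d.1.2.1 in let s := d.1.2.2 in
  let t := d.2.1.1 in let steps := d.2.1.2 in let a := d.2.2.1 in let b := d.2.2.2 in
  [&& cube_test r m q, all (cube_test r m) s, confirms s t steps a b &
    (cube_weight r * b < a * 2 ^ k)%N].

Definition request_of (d : request_data) : option (request_key * bitstring) :=
  if granted d then Some (d.1.1, vec_code d.1.2.1) else None.

Definition request (i : nat) : option (request_key * bitstring) :=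
  request_of (dec i : request_data).

Lemma cmp_confirms X {rX : rep X} (s : X -> seq 'rV[rat]_n) (t u a b : X -> nat) :
  cmp s -> cmp t -> cmp u -> cmp a -> cmp b ->
  cmp (fun x => confirms (s x) (t x) (u x) (a x) (b x)).
Proof.
move=> cs ct cu ca cb; have ci := cmp_approx_input cs ct.
have cr := @cmp_tm_result N _ _ _ _ cu ci.
have cf : cmp (fun x => frac_code (a x) (b x)).
  by apply: cmp_pair_code; apply: cmp_int_code; exact: cmp_posz.
rewrite /confirms; eapply cmp_opt => //; last by cmp_tac.
by eapply cmp_eq; [exact: ceq_seq | cmp_tac | cmp_tac].
Qed.

Lemma cmp_request : cmp request.
Proof.
apply: (cmp_comp (f := request_of)); last exact: cmp_dec.
have cg : cmp granted.
  rewrite /granted; cbv zeta; eapply cmp_andb; first by eapply cmp_cube_test; cmp_tac.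
  eapply cmp_andb; first by eapply cmp_all; [eapply cmp_cube_test|]; cmp_tac.
  eapply cmp_andb; first by eapply cmp_confirms; cmp_tac.
  by rewrite /cube_weight; cmp_tac.
have cv : cmp (fun q : 'rV[rat]_n => vec_code q) by apply: cmp_vec_code; exact: cmp_id.
rewrite /request_of; cmp_tac.
Qed.

Definition threshold (r k : nat) : R := (cube_weight r)%:R / 2 ^+ k.

Lemma request_sound i r m k w : request i = Some ((r, m, k), w) ->
  exists q (A : {fset 'rV[rat]_n}), [/\ w = vec_code q, cube_test r m q,
    forall x, x \in A -> cube_test r m x &
    ((threshold r k)%:E < nu (finset_points R A))%E].
Proof.
rewrite /request; case: (dec i) => -[[[r' m'] k'] [q s]] [[t u] [a b]].
rewrite /request_of; case: ifP => //= /and4P[mq ms cf lt] [<- <- <- <-].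
move: mq ms cf lt => /= mq /allP ms cf lt.
exists q, [fset x in s]%fset; split => // [x|]; first by rewrite in_fset => /ms.
apply: (@lt_le_trans _ _ (ratr (nuhat [fset x in s]%fset t) : R)%:E); last exact: nuhat_le.
have cN : computes N (approx_input s t) (rat_code (nuhat [fset x in s]%fset t)).
  by apply: nuhat_computed; exists s; split => // x; rewrite in_fset.
move: cf; rewrite /confirms; case Et: tm_result => [v|] // /eqP vE.
have /(computes_fun cN) : computes N (approx_input s t) v by apply/tm_resultP; exists u.
rewrite vE => /pair_code_inj[/int_code_inj na /int_code_inj db].
have b0 : (0 < b)%N by rewrite -ltz_nat -db denq_gt0.
rewrite lte_fin /ratr na db /threshold ltr_pdivrMr ?exprn_gt0 // mulrAC ltr_pdivlMr ?ltr0n //.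
by rewrite -[a%:Z%:~R]/(a%:R) -natrX -!natrM ltr_nat.
Qed.

Definition point_mass (q : 'rV[rat]_n) : R := fine (nu [set ratvec R q]).
Definition total_mass : R := fine (\esum_(q in [set: 'rV[rat]_n]) nu [set ratvec R q]).

Lemma point_mass_ge0 q : 0 <= point_mass q.
Proof. by rewrite fine_ge0. Qed.

Lemma sum_point_mass (A : {fset 'rV[rat]_n}) :
  (\sum_(q <- A) nu [set ratvec R q] <=
   \esum_(q in [set: 'rV[rat]_n]) nu [set ratvec R q])%E.
Proof.
apply: esum_ge; exists [set` A]; first by split => //; exact: finite_fset.
by rewrite fsbig_finite ?set_fsetK //; exact: finite_fset.
Qed.

Lemma point_massE q : nu [set ratvec R q] = (point_mass q)%:E.
Proof.
rewrite fineK // ge0_fin_numE //; apply: le_lt_trans nu_mass.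
by have := sum_point_mass [fset q]%fset; rewrite big_seq_fset1.
Qed.

Lemma sum_point_mass_le (s : seq 'rV[rat]_n) : uniq s ->
  \sum_(q <- s) point_mass q <= total_mass.
Proof.
move=> us; rewrite -lee_fin fineK; last first.
  by rewrite ge0_fin_numE // esum_ge0.
apply: le_trans (sum_point_mass [fset x in s]%fset).
rewrite -sumEFin (perm_big (enum_fset [fset x in s]%fset)).
  by under eq_bigr do rewrite -point_massE.
by apply: uniq_perm => // x; rewrite in_fset.
Qed.

Lemma nu_finset_le (A : {fset 'rV[rat]_n}) :
  (nu (finset_points R A) <= (\sum_(q <- A) point_mass q)%:E)%E.
Proof.
suff le (s : seq 'rV[rat]_n) : (nu (ratvec R @` [set q | q \in s]) <=
    (\sum_(q <- s) point_mass q)%:E)%E by exact: le.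
elim: s => [|q s IH].
  rewrite big_nil (_ : _ @` _ = set0) ?outer_measure0 //.
  by rewrite -subset0 => x [].
rewrite big_cons EFinD; apply: le_trans (leeD (lexx _) IH); rewrite -point_massE.
apply: le_trans (outer_measureU2 _ _ _); apply: le_outer_measure => _ [x + <-].
by rewrite /mkset inE => /predU1P[->|xs]; [left | right; exists x].
Qed.

(** A finite set that misses measure less than 1 spares a countable sum; any explicit finite bound
    serves the purpose. *)
Lemma nu_le_total E : (nu E <= (total_mass + 1)%:E)%E.
Proof.
have [A A1] := nu_support ltr01.
apply: (@le_trans _ _ (nu (finset_points R A) + nu (~` finset_points R A)))%E.
  apply: le_trans (outer_measureU2 _ _ _); apply: le_outer_measure.
  by rewrite setUv.
rewrite EFinD; apply: leeD; last exact: ltW.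
by apply: (le_trans (nu_finset_le A)); rewrite lee_fin; apply: sum_point_mass_le; exact: fset_uniq.
Qed.

Lemma nu_fin E : nu E = (fine (nu E))%:E.
Proof.
by rewrite fineK // ge0_fin_numE //; apply: le_lt_trans (nu_le_total E) _; rewrite ltry.
Qed.

Lemma threshold_ge0 r k : 0 <= threshold r k.
Proof. by rewrite divr_ge0 ?ler0n // exprn_ge0. Qed.

(** The gap between [nu Q] and the threshold is spent on the complement of a finite set [A0]. By
    subadditivity the points of [A0] inside [Q] still exceed the threshold, and hence so does some
    stage of [nuhat]. *)
Lemma request_complete r m k : ((threshold r k)%:E < nu (dyadic_cube r m))%E ->
  exists i w, request i = Some ((r, m, k), w).
Proof.
set Q := dyadic_cube r m => lt.
have [|A0 A0E] := nu_support (_ : 0 < fine (nu Q) - threshold r k).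
  by rewrite subr_gt0 -lte_fin -nu_fin.
pose A := [fset q in A0 | cube_test r m q]%fset.
have ltA : ((threshold r k)%:E < nu (finset_points R A))%E.
  have : (nu Q <= nu (finset_points R A) + nu (~` finset_points R A0))%E.
    apply: le_trans (outer_measureU2 _ _ _); apply: le_outer_measure => x Qx.
    have [[q qA0 qx]|nA0] := pselect (finset_points R A0 x); last by right.
    left; exists q => //; rewrite /mkset /A !inE /=.
    by apply/andP; split => //; apply/(cube_testP R); rewrite qx.
  move: A0E; rewrite (nu_fin Q) (nu_fin (finset_points _ A)) (nu_fin (~` _)).
  by rewrite -EFinD !lte_fin lee_fin; lra.
have [t tE] : exists t, threshold r k < ratr (nuhat A t).
  apply: contrapT => nt; move: ltA; rewrite ltNge => /negP; apply.
  apply: cvge_le (@nuhat_cvg A); near=> t; rewrite lee_fin leNgt; apply/negP => lt_t.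
  by apply: nt; exists t.
have [q qA] : exists q, q \in A.
  apply/fset0Pn/eqP => A0'; move: ltA; rewrite A0' ltNge => /negP; apply.
  rewrite (_ : finset_points R fset0 = set0) ?outer_measure0 ?lee_fin ?threshold_ge0 //.
  by rewrite -subset0 => x [y]; rewrite /mkset inE.
have cA x : x \in A -> cube_test r m x by rewrite !inE /= => /andP[].
have [u uE] : exists u, tm_result N u (approx_input A t) = Some (rat_code (nuhat A t)).
  by apply/tm_resultP/nuhat_computed; exists A.
pose a := `|numq (nuhat A t)|%N; pose b := `|denq (nuhat A t)|%N.
have aE : numq (nuhat A t) = Posz a by rewrite gez0_abs // numq_ge0.
have bE : denq (nuhat A t) = Posz b by rewrite gez0_abs // ltW // denq_gt0.
have b0 : (0 < b)%N by rewrite -ltz_nat -bE denq_gt0.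
exists (enc (((r, m, k), (q, A : seq _), ((t, u), (a, b))) : request_data)), (vec_code q).
rewrite /request encK /request_of.
suff -> : granted ((r, m, k), (q, A : seq _), ((t, u), (a, b))) by [].
apply/and4P; split; rewrite /=; first exact: cA.
- by apply/allP => x; exact: cA.
- by rewrite /confirms uE /rat_code aE bE.
move: tE; rewrite /threshold /ratr aE bE ltr_pdivrMr ?exprn_gt0 // mulrAC.
by rewrite ltr_pdivlMr ?ltr0n // -[a%:Z%:~R]/(a%:R) -natrX -!natrM ltr_nat.
Unshelve. all: by end_near.
Qed.

(** After exchanging the sums, each point counts at most once, because it lies in at most one cube
    of the level. *)
Lemma sum_cube_mass r (ms : seq 'rV[int]_n) (B : seq 'rV[rat]_n) : uniq ms -> uniq B ->
  \sum_(m <- ms) \sum_(q <- B | cube_test r m q) point_mass q <= total_mass.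
Proof.
move=> ums uB; apply: le_trans (sum_point_mass_le uB).
under eq_bigr do rewrite big_mkcond.
rewrite exchange_big /=; apply: ler_sum => q _.
have [/hasP[m mms mq]|/hasPn nm] := boolP (has (fun m => cube_test r m q) ms).
  rewrite (bigD1_seq m) //= mq big1 ?addr0 // => m' m'm.
  by case: ifP => // /(cube_test_uniq R mq) E; rewrite E eqxx in m'm.
by rewrite big_seq big1 ?point_mass_ge0 // => m /nm /negbTE ->.
Qed.

Lemma requests_kraft c : 2 * total_mass <= 2 ^+ c ->
  forall ks, uniq ks -> (forall key, key \in ks -> requested request key) ->
  kraft_sum R (fun key : request_key => key.2 + c)%N ks <= 1.
Proof.
move=> cE ks uks req.
have /choice[W WE] : forall key : request_key, exists A : {fset 'rV[rat]_n},
    requested request key -> (forall x, x \in A -> cube_test key.1.1 key.1.2 x) /\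
    ((threshold key.1.1 key.2)%:E < nu (finset_points R A))%E.
  move=> [[r m] k]; have [[i [w E]]|nreq] := pselect (requested request (r, m, k)).
    by have [q [A [_ _ AE lt]]] := request_sound E; exists A.
  by exists fset0 => /nreq.
(* Pooling the witnesses of all keys gives a mass [V r m] that does not depend on [k], so the
   requests for one cube satisfy a single bound [2^-k < V r m / cube_weight r]. *)
pose B := undup (flatten [seq enum_fset (W key) | key <- ks]).
pose V r m := \sum_(q <- B | cube_test r m q) point_mass q.
have V0 r m : 0 <= V r m by apply: sumr_ge0 => q _; exact: point_mass_ge0.
have w0 r : 0 < (cube_weight r)%:R :> R by rewrite ltr0n.
pose P (key : request_key) := 2 ^- key.2 < V key.1.1 key.1.2 / (cube_weight key.1.1)%:R.
have PE key : key \in ks -> P key.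
  move=> kks; have [cW ltW'] := WE _ (req _ kks).
  rewrite /P ltr_pdivlMr // mulrC -lte_fin; apply: (lt_le_trans ltW').
  apply: (le_trans (nu_finset_le _)); rewrite lee_fin; apply: ler_sum_subset.
  - exact: fset_uniq.
  - exact: undup_uniq.
  - move=> q qW; split; first exact: cW.
    by rewrite mem_undup; apply/flattenP; exists (enum_fset (W key)) => //; apply/mapP; exists key.
  - exact: point_mass_ge0.
pose rs := iota 0 (\max_(key <- ks) key.1.1).+1.
pose ms := undup [seq key.1.2 | key <- ks].
pose kk := iota 0 (\max_(key <- ks) key.2).+1.
(* Enlarging [ks] to a box makes the sum iterated: geometric in [k], bounded by the total mass in
   [m], telescoping in [r]. *)
pose L := [seq (rm, k) | rm <- [seq (r, m) | r <- rs, m <- ms], k <- kk].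
have le1 : \sum_(key <- ks) 2 ^- key.2 <= \sum_(key <- L | P key) 2 ^- key.2 :> R.
  apply: ler_sum_subset => //.
  - apply: allpairs_uniq; [|exact: iota_uniq|by move=> [? ?] [? ?]].
    by apply: allpairs_uniq; [exact: iota_uniq|exact: undup_uniq|move=> [? ?] [? ?]].
  - move=> [[r m] k] kks; split; first exact: PE.
    apply: allpairs_f; last by rewrite mem_iota add0n ltnS (leq_bigmax_seq (r, m, k)).
    apply: allpairs_f; first by rewrite mem_iota add0n ltnS (leq_bigmax_seq (r, m, k)).
    by rewrite mem_undup; apply/mapP; exists (r, m, k).
have le2 : \sum_(key <- L | P key) 2 ^- key.2 <= 2 * total_mass :> R.
  rewrite big_mkcond big_allpairs big_allpairs /=.
  apply: (@le_trans _ _ (\sum_(r <- rs) (cube_weight r)%:R^-1 * (2 * total_mass))).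
    apply: ler_sum => r _.
    apply: (@le_trans _ _ (\sum_(m <- ms) 2 * (V r m / (cube_weight r)%:R))).
      apply: ler_sum => m _; rewrite -big_mkcond.
      have q0 : 0 <= V r m / (cube_weight r)%:R by rewrite divr_ge0 // ltW.
      exact: (sum_pow2N_lt _ q0).
    rewrite -mulr_sumr -mulr_suml mulrA [leRHS]mulrC ler_pM2r ?invr_gt0 //.
    by rewrite ler_wpM2l // sum_cube_mass // undup_uniq.
  rewrite -mulr_suml -[leRHS]mul1r ler_wpM2r ?sum_cube_weight //.
  by rewrite mulr_ge0 // (le_trans _ (sum_point_mass_le (isT : uniq [::]))) ?big_nil.
rewrite /kraft_sum; under eq_bigr do rewrite exprD invfM.
rewrite -mulr_suml ler_pdivrMr ?exprn_gt0 // mul1r.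
exact: le_trans le1 (le_trans le2 cE).
Qed.

Lemma kappa_dominates U : universal_prefix_machine U ->
  dominates_on_dyadic_cubes (kappa R n U) nu.
Proof.
move=> [_ Uuniv].
(* The same [c] has to bound both the Kraft sum and [nu Q] itself, whence [total_mass + 1]. *)
have [c cE] : exists c, 2 * (total_mass + 1) <= 2 ^+ c.
  exists (Num.bound (2 * (total_mass + 1))).
  have T0 : 0 <= total_mass.
    by rewrite (le_trans _ (sum_point_mass_le (isT : uniq [::]))) ?big_nil.
  apply: (le_trans (ltW (archi_boundP _))); first by lra.
  by rewrite -natrX ler_nat ltnW // ltn_expl.
have T0 : 0 <= total_mass.
  by rewrite (le_trans _ (sum_point_mass_le (isT : uniq [::]))) ?big_nil.
have cE' : 2 * total_mass <= 2 ^+ c by lra.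
have clen : cmp (fun key : request_key => key.2 + c)%N by cmp_tac.
have [|M [Mpf ME]] := @kraft_chaitin R _ _ _ _ _ clen cmp_request.
  exact: requests_kraft.
have [e eE] := Uuniv M Mpf.
(* Three losses: a factor [2^(c+1)] between [nu Q] and the best threshold, [c.+1] bits in a codeword
   of length [k + c + 1], and [e] bits for the passage to [U]. *)
pose d := (c.+1 + (c.+1 + e))%N.
have w0 r : 0 < (cube_weight r)%:R :> R by rewrite ltr0n.
exists (fun r => 2 ^- d / (cube_weight r)%:R); split.
- by move=> r; rewrite divr_gt0 // invr_gt0 exprn_gt0.
- exact: exp2_littleo_weight.
move=> r E [m _ <-]; set Q := dyadic_cube r m.
have [nu0|nu0] := leP (nu Q) 0%E.
  have -> : nu Q = 0%E by apply/eqP; rewrite eq_le nu0 outer_measure_ge0.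
  by rewrite mule0; exact: kappa_ge0.
rewrite nu_fin in nu0 *; set v := fine (nu Q) in nu0 *; rewrite lte_fin in nu0.
have vT : v <= 2 ^+ c.
  have : v <= total_mass + 1 by rewrite -lee_fin -nu_fin nu_le_total.
  by lra.
have ex : exists k, threshold r k < v.
  have [|k kE] := @pow2N_lt R (v / (cube_weight r)%:R); first by rewrite divr_gt0.
  by exists k; move: kE; rewrite ltr_pdivlMr // mulrC.
have [k kv kmin] := ex_minnP ex.
(* For [k > 0] minimality gives a factor 2. For [k = 0] there is no smaller exponent to compare
   with, and the bound [v <= 2^c] is used. *)
have kE : v <= threshold r k * 2 ^+ c.+1.
  case: k {kv} kmin => [_|k /(_ k) kmin].
    rewrite /threshold expr0 invr1 mulr1 exprS.
    have : 1 <= (cube_weight r)%:R :> R by rewrite ler1n.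
    by have : 0 < 2 ^+ c :> R by []; nra.
  have vk : v <= threshold r k by rewrite leNgt; apply/negP => /kmin; rewrite ltnn.
  have -> : threshold r k.+1 * 2 ^+ c.+1 = threshold r k * 2 ^+ c.
    by rewrite /threshold !exprS; field; rewrite expf_neq0 // pnatr_eq0.
  by apply: (le_trans vk); rewrite ler_peMr ?threshold_ge0 // exprn_ege1 // ler1n.
have [i [w Ei]] : exists i w, request i = Some ((r, m, k), w).
  by apply: request_complete; rewrite -/Q (nu_fin Q) lte_fin.
(* The codeword may output the point of another request with the same key; soundness places that
   point in the same cube. *)
have [j [p [w' [Ej cp sp]]]] := ME _ _ _ Ei.
have [q [_ [w'E mq _ _]]] := request_sound Ej.
have [p' [cp' sp']] := eE _ _ cp.
have qQ : Q (ratvec R q) by apply/cube_testP.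
rewrite w'E in cp'; apply: le_trans (kappa_ge qQ cp').
rewrite -EFinM lee_fin; apply: (@le_trans _ _ (2 ^- (k + (c.+1 + e)))); last first.
  rewrite lef_pV2 ?posrE ?exprn_gt0 // ler_weXn2l ?ler1n //.
  by move: sp'; rewrite sp /=; lia.
rewrite -mulrA [_^-1 * v]mulrC.
apply: (@le_trans _ _ (2 ^- d * (2 ^+ c.+1 / 2 ^+ k))).
  rewrite ler_wpM2l ?invr_ge0 ?exprn_ge0 // ler_pdivrMr //.
  by apply: (le_trans kE); rewrite /threshold; move: (2 ^- k) (2 ^+ c.+1) => x y; lra.
have E2 x : 2 ^+ x != 0 :> R by rewrite expf_neq0 // pnatr_eq0.
rewrite /d (exprD _ c.+1 (c.+1 + e)) (exprD _ k).
have := E2 k; have := E2 c.+1; have := E2 (c.+1 + e)%N.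
move: (2 ^+ k) (2 ^+ c.+1) (2 ^+ (c.+1 + e)) => x y z x0 y0 z0.
by rewrite le_eqVlt; apply/orP; left; apply/eqP; field; rewrite x0 y0 z0.
Qed.

End Requests.

Theorem theorem4p5 (R : realType) (n : nat) (U : turing_machine)
    (n_ge1 : (1 <= n)%N) (U_universal : universal_prefix_machine U) :
  locally_optimal (kappa R n U).
Proof.
have [Upf _] := U_universal; split.
- exact: kappa_strongly_finite.
- exact: kappa_lower_semicomputable.
move=> nu [_ nu_mass] [nu_support [nuhat [[N NE] nuhat_ge0 nuhat_mono nuhat_cvg]]].
apply: (@kappa_dominates R n nu N nuhat) => // A t.
by have [] := nuhat_mono A t t (leqnn _).
Qed.
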